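(* Let $\Omega\subset\mathbb{R}^2$ be a convex compact set with $0\in\mathrm{int}\,\Omega$, and let $\Omega^\circ$ be its polar set. The functions $\cos_\Omega$ and $\sin_\Omega$ are Lipschitz continuous on $\mathbb{R}$ and have a left and a right derivative at every $\theta\in\mathbb{R}$; the left and right derivatives coincide for almost every $\theta$. Denote by $\cos'_\Omega\theta$ (respectively $\sin'_\Omega\theta$) the whole closed interval between the left and the right derivative of $\cos_\Omega$ (respectively $\sin_\Omega$) at $\theta$. Then for any $\theta\leftrightarrow\theta^\circ$, $$-\sin_{\Omega^\circ}\theta^\circ\in\cos'_\Omega\theta\qquad\text{and}\qquad \cos_{\Omega^\circ}\theta^\circ\in\sin'_\Omega\theta .$$ Moreover, for any $\theta\in\mathbb{R}$, $$\cos'_\Omega\theta=\{-\sin_{\Omega^\circ}\theta^\circ:\ \theta^\circ\leftrightarrow\theta\},\qquad \sin'_\Omega\theta=\{\cos_{\Omega^\circ}\theta^\circ:\ \theta^\circ\leftrightarrow\theta\}.$$ The similar formulae hold for the polar set: for any $\theta^\circ\in\mathbb{R}$, $$\cos'_{\Omega^\circ}\theta^\circ=\{-\sin_{\Omega}\theta:\ \theta\leftrightarrow\theta^\circ\},\qquad \sin'_{\Omega^\circ}\theta^\circ=\{\cos_{\Omega}\theta:\ \theta\leftrightarrow\theta^\circ\}.$$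
   Context: Notation. For a convex compact set $\Omega\subset\mathbb{R}^2$ with $0\in\mathrm{int}\,\Omega$, let $\mathbb{S}(\Omega)$ denote its area. Generalized trigonometric functions: for $0\le\theta<2\mathbb{S}(\Omega)$ let $P_\theta\in\partial\Omega$ be the boundary point such that the sector of $\Omega$ swept counterclockwise from the ray $Ox$ (the positive $x$-axis) to the ray $OP_\theta$ has area $\frac12\theta$. Extend $P_\theta$ to all $\theta\in\mathbb{R}$ periodically with period $2\mathbb{S}(\Omega)$. Then $\cos_\Omega\theta$ and $\sin_\Omega\theta$ are by definition the coordinates of $P_\theta$: $P_\theta=(\cos_\Omega\theta,\sin_\Omega\theta)$. The polar set is $\Omega^\circ=\{(p,q)\in\mathbb{R}^2: px+qy\le 1\text{ for all }(x,y)\in\Omega\}$; it is again convex and compact with $0\in\mathrm{int}\,\Omega^\circ$, so $\cos_{\Omega^\circ},\sin_{\Omega^\circ}$ are defined by the same construction; write $Q_\psi=(\cos_{\Omega^\circ}\psi,\sin_{\Omega^\circ}\psi)\in\partial\Omega^\circ$ for $\psi\in\mathbb{R}$. Correspondence: for $\theta,\theta^\circ\in\mathbb{R}$, $\theta\leftrightarrow\theta^\circ$ (equivalently written $\theta^\circ\leftrightarrow\theta$) means that the covector $Q_{\theta^\circ}$ determines a supporting half-plane of $\Omega$ at $P_\theta$, i.e. $\langle Q_{\theta^\circ},P_\theta\rangle=\max_{P\in\Omega}\langle Q_{\theta^\circ},P\rangle$, where $\langle\cdot,\cdot\rangle$ is the standard pairing. *)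

(* Defs.v *)
From HB Require Import structures.
From mathcomp Require Import all_boot all_order all_algebra.
From mathcomp Require Import all_classical all_reals all_analysis.

Set Implicit Arguments.
Unset Strict Implicit.
Unset Printing Implicit Defensive.

Import Order.TTheory GRing.Theory Num.Theory.
Import numFieldNormedType.Exports.

Local Open Scope classical_set_scope.
Local Open Scope ring_scope.

Definition area (R : realType) (A : set (R * R)) : R :=
  fine ((@lebesgue_measure R \x @lebesgue_measure R)%E A).

Definition boundary (T : topologicalType) (A : set T) : set T :=
  closure A `\` A°.

Definition pairing (R : realType) (q x : R * R) : R := q.1 * x.1 + q.2 * x.2.

Definition polar (R : realType) (Omega : set (R * R)) : set (R * R) :=
  [set q | forall x, Omega x -> pairing q x <= 1].

(* The closed half-line from the origin in the direction of angle t. *)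
Definition ray (R : realType) (t : R) : set (R * R) :=
  [set (r * cos t, r * sin t) | r in [set r : R | 0 <= r]].

(* The part of Omega swept counterclockwise from ray 0 to ray a
   (meaningful for 0 <= a < 2 * pi). *)
Definition sector (R : realType) (Omega : set (R * R)) (a : R) : set (R * R) :=
  Omega `&` \bigcup_(t in [set t : R | 0 <= t <= a]) ray t.

(* For 0 <= theta < 2 * area Omega: P is the boundary point whose sector has
   area theta / 2. *)
Definition bdpoint_spec (R : realType) (Omega : set (R * R)) (theta : R)
    (P : R * R) : Prop :=
  boundary Omega P /\
  exists a : R, [/\ 0 <= a < 2 * pi, ray a P
                  & area (sector Omega a) = theta / 2].

(* The representative of theta modulo p in [0, p), for p > 0. *)
Definition modR (R : realType) (p theta : R) : R :=
  theta - (Num.floor (theta / p))%:~R * p.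

(* When Omega is convex and compact with 0 in its interior, exactly one point
   satisfies the specification, so the default value of get plays no role. *)
Definition bdpoint (R : realType) (Omega : set (R * R)) (theta : R) : R * R :=
  get (bdpoint_spec Omega (modR (2 * area Omega) theta)).

Definition gcos (R : realType) (Omega : set (R * R)) (theta : R) : R :=
  (bdpoint Omega theta).1.

Definition gsin (R : realType) (Omega : set (R * R)) (theta : R) : R :=
  (bdpoint Omega theta).2.

Definition is_max (R : realType) (A : set R) (m : R) : Prop :=
  A m /\ ubound A m.

(* theta <-> theta': the covector with parameter theta' on the boundary of the
   polar set supports Omega at the point with parameter theta. *)
Definition corresp (R : realType) (Omega : set (R * R)) (theta theta' : R)
    : Prop :=
  let Q := bdpoint (polar Omega) theta' in
  is_max [set pairing Q x | x in Omega] (pairing Q (bdpoint Omega theta)).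

Definition is_lderive (R : realType) (f : R -> R) (x l : R) : Prop :=
  h^-1 * (f (x + h) - f x) @[h --> 0^'-] --> l.

Definition is_rderive (R : realType) (f : R -> R) (x l : R) : Prop :=
  h^-1 * (f (x + h) - f x) @[h --> 0^'+] --> l.

(* The closed interval between the left and the right derivative of f at x, in
   whichever order they come; it is empty if one of them does not exist. *)
Definition deriv_itv (R : realType) (f : R -> R) (x : R) : set R :=
  [set v | exists l r, [/\ is_lderive f x l, is_rderive f x r
                         & Num.min l r <= v <= Num.max l r]].

(* Existence and a.e. equality of the one-sided derivatives. *)
Definition has_sided_derivs (R : realType) (f : R -> R) : Prop :=
  (forall x, (exists l, is_lderive f x l) /\ (exists r, is_rderive f x r)) /\
  {ae @lebesgue_measure R,
    forall x, exists d, is_lderive f x d /\ is_rderive f x d}.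

(* Main.v *)
Require Import Defs.
From HB Require Import structures.
From mathcomp Require Import all_boot all_order all_algebra.
From mathcomp Require Import all_classical all_reals all_analysis.
From mathcomp Require Import measurable_realfun.
From mathcomp Require Import ring lra zify.

Set Implicit Arguments.
Unset Strict Implicit.
Unset Printing Implicit Defensive.

Import Order.TTheory GRing.Theory Num.Theory.
Import numFieldNormedType.Exports.

Local Open Scope classical_set_scope.
Local Open Scope ring_scope.

(** Write <q, x> for the pairing, K for the convex body, K' for its polar and
P(theta) for the boundary point with parameter theta.

Take two nearby points P0 = P(theta) and P1 = P(theta + h).  The part of K swept
between them contains the triangle 0 P0 P1 and lies in the triangle cut out of
the same angle by any support line at P0, so that h = det(P0, P1) (1 + o(1))
([bdpoint_local], [area_ratio_cvg]).  On the other hand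
P1 - P0 = det(P0, P1) J Q, where J is the rotation by a quarter turn and Q is
the covector of the chord, <Q, P0> = <Q, P1> = 1 ([chordE]).  Hence the
difference quotients of (gcos, gsin) have the same limit as J Q.

To find the limit of Q, use t = det(P0, Q) as a coordinate on the line
<Q, P0> = 1.  The covectors of K' on this line form the face of K' exposed by
P0, a compact segment.  Because K lies on one side of its support lines, the
coordinate of the chord lies between that of the nearest end of the face and
that of any covector supporting K at P1 ([le_chord_slope], [chord_slope_le]).
As h tends to 0, covectors supporting K at P1 accumulate at the face, because K'
is compact ([face_usc]).  So Q tends to one end of the face when h > 0 and to
the other when h < 0 ([bdpoint_side_derivative]), and the derivative intervals
are the two coordinate projections of J applied to the face
([deriv_itv_face]).

The covectors of the face are the boundary points of K' whose parameters
correspond to theta ([face_image]); this gives the formulae for K.  Since the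
polar of K' is K ([bipolar]), the correspondence is symmetric, and the formulae
for K' are those for K with the two bodies exchanged.

The two one-sided derivatives differ only where the face is a nondegenerate
segment.  The open triangles spanned by 0 and such segments are disjoint for
distinct boundary points, hence there are countably many of them
([countable_corner]).

This rests on three elementary facts.  Support lines exist: in the plane this
is the Hahn-Banach theorem for one real unknown ([boundary_support]).  The plane
Lebesgue measure is multiplied by the determinant under a linear map
([area_linear]), which gives the area of triangles and the nullity of lines.  The
swept area is continuous and strictly increasing in the angle, so that P is well
defined and runs through the whole boundary ([bdpoint_spec_unique],
[bdpointP], [bdpoint_surj]). *)

(** * Convex bodies and their polars *)

Definition det (R : realType) (x y : R * R) : R := x.1 * y.2 - x.2 * y.1.

Record convex_body (R : realType) (K : set (R * R)) : Prop := ConvexBody {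
  body_convex : convex_set K;
  body_compact : compact K;
  body_int0 : K° 0 }.

Section ConvexBody.
Context {R : realType}.
Implicit Types (K : set (R * R)) (x y u P Q : R * R).

Lemma convex_setP K : convex_set K <->
  forall x y t, K x -> K y -> 0 <= t <= 1 ->
    K (t * x.1 + (1 - t) * y.1, t * x.2 + (1 - t) * y.2).
Proof.
split=> [cK x y t Kx Ky t01|cK x y t].
  have := cK x y (Itv01 (andP t01).1 (andP t01).2).
  by rewrite !inE => /(_ Kx Ky).
by rewrite !inE => Kx Ky; apply: (cK x y t%:num) => //; rewrite ge0 le1.
Qed.

Lemma prod_norm_le x (e : R) : (`|x| <= e) = (`|x.1| <= e) && (`|x.2| <= e).
Proof. by rewrite prod_normE ge_max. Qed.

Lemma linear_form_continuous (a b : R) :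
  continuous (fun x : R * R => a * x.1 + b * x.2).
Proof.
move=> x; apply: cvgD.
  by apply: cvgM; [exact: cvg_cst|exact: cvg_fst].
by apply: cvgM; [exact: cvg_cst|exact: cvg_snd].
Qed.

Lemma closed_halfplane (a b c : R) :
  closed [set x : R * R | a * x.1 + b * x.2 <= c].
Proof.
have /continuous_closedP := @linear_form_continuous a b.
by move=> /(_ _ (@closed_le R c)).
Qed.

Lemma interior_box K x :
  K° x <-> exists2 r : R, 0 < r &
    forall y, `|y.1 - x.1| <= r -> `|y.2 - x.2| <= r -> K y.
Proof.
split=> [/nbhs_ballP[e /= e0 eK]|[r r0 rK]].
  exists (e / 2); first by rewrite divr_gt0.
  move=> y y1 y2; apply: eK; rewrite -ball_normE /= distrC.
  rewrite (le_lt_trans _ (_ : e / 2 < e))//; last lra.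
  by rewrite prod_norm_le y1.
apply/nbhs_ballP; exists r => //= y; rewrite -ball_normE /= distrC => /ltW.
by rewrite prod_norm_le => /andP[y1 y2]; exact: rK.
Qed.

Lemma body_bounded K : convex_body K ->
  exists2 M : R, 0 < M & forall x, K x -> `|x.1| <= M /\ `|x.2| <= M.
Proof.
move=> [_ /compact_bounded[M [_ bK]] _]; exists (`|M| + 1).
  by rewrite ltr_wpDl.
move=> x Kx; apply/andP; rewrite -prod_norm_le; apply: bK => //.
by rewrite (le_lt_trans (ler_norm M))// ltrDl.
Qed.

Lemma body_closed K : convex_body K -> closed K.
Proof. by move=> [_ cK _]; apply: compact_closed => //; exact: norm_hausdorff. Qed.

Lemma body0 K : convex_body K -> K 0.
Proof. by move=> [_ _ /interior_subset]. Qed.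

Lemma body_conv K x y t : convex_body K -> K x -> K y -> 0 <= t <= 1 ->
  K (t * x.1 + (1 - t) * y.1, t * x.2 + (1 - t) * y.2).
Proof. by move=> [/convex_setP cK _ _]; exact: cK. Qed.

Lemma body_shrink K x c : convex_body K -> K x -> 0 <= c <= 1 ->
  K (c * x.1, c * x.2).
Proof.
move=> bK Kx c01; have := body_conv bK Kx (body0 bK) c01.
by rewrite /= !mulr0 !addr0.
Qed.

(** A boundary point cannot be pushed outwards: if c P is in K with 1 < c, then P is
interior, as a convex combination of c P and of a box around 0. *)
Lemma boundaryP K P : convex_body K ->
  boundary K P <-> K P /\ forall c, 1 < c -> ~ K (c * P.1, c * P.2).
Proof.
move=> bK; rewrite /boundary -(closure_id _).1; last exact: body_closed.
split=> [[KP nP]|[KP nP]]; split => //.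
  move=> c c1 KcP; apply: nP; apply/interior_box.
  have [r r0 rK] := (interior_box K 0).1 (body_int0 bK).
  have c0 : 0 < c by exact: lt_trans c1.
  have d0 : 0 < 1 - c^-1 by rewrite subr_gt0 invf_lt1.
  exists ((1 - c^-1) * r); first by rewrite mulr_gt0.
  move=> y y1 y2.
  have Kz : K ((y.1 - P.1) / (1 - c^-1), (y.2 - P.2) / (1 - c^-1)).
    by apply: rK; rewrite /= subr0 normrM normfV (gtr0_norm d0)
      ler_pdivrMr// mulrC.
  have := body_conv bK KcP Kz (_ : 0 <= c^-1 <= 1).
  rewrite /= !mulKf ?gt_eqF// ![(1 - _) * _]mulrC !divfK ?gt_eqF//.
  rewrite !(addrC P.1, addrC P.2) !subrK -surjective_pairing; apply.
  by rewrite invr_ge0 ltW//= invf_le1// ltW.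
move=> /interior_box[r r0 rK].
pose M := 1 + `|P.1| + `|P.2|.
have M0 : 0 < M by rewrite /M; have := normr_ge0 P.1; have := normr_ge0 P.2; lra.
have ineq (a : R) : `|a| <= M -> `|(1 + r / M) * a - a| <= r.
  move=> aM; rewrite (_ : _ - a = r / M * a); last by ring.
  rewrite normrM gtr0_norm ?divr_gt0// mulrAC ler_pdivrMr//.
  by rewrite ler_wpM2l ?(ltW r0).
apply: (nP (1 + r / M)); first by rewrite ltrDl divr_gt0.
by apply: rK; apply: ineq; rewrite /M; have := normr_ge0 P.1;
  have := normr_ge0 P.2; lra.
Qed.

Lemma boundary_subset K P : convex_body K -> boundary K P -> K P.
Proof. by move=> bK /(boundaryP _ bK)[]. Qed.

Lemma boundary_neq0 K P : convex_body K -> boundary K P ->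
  0 < P.1 ^+ 2 + P.2 ^+ 2.
Proof.
move=> bK /(boundaryP _ bK)[_ nP]; rewrite lt_neqAle addr_ge0 ?sqr_ge0// andbT.
rewrite eq_sym paddr_eq0 ?sqr_ge0// !sqrf_eq0; apply/negP => /andP[/eqP P1 /eqP P2].
by apply: (nP 2); [rewrite ltr1n|rewrite P1 P2 !mulr0; exact: body0].
Qed.

Lemma boundary_collinear_le K P x : convex_body K -> boundary K P -> K x ->
  det P x = 0 -> pairing P x <= P.1 ^+ 2 + P.2 ^+ 2.
Proof.
move=> bK bP Kx; rewrite /det /pairing => dPx.
have n0 := boundary_neq0 bK bP.
have [_ nP] := (boundaryP _ bK).1 bP.
rewrite leNgt; apply/negP => lt.
apply: (nP ((P.1 * x.1 + P.2 * x.2) / (P.1 ^+ 2 + P.2 ^+ 2))).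
  by rewrite ltr_pdivlMr// mul1r.
suff <- : x = ((P.1 * x.1 + P.2 * x.2) / (P.1 ^+ 2 + P.2 ^+ 2) * P.1,
  (P.1 * x.1 + P.2 * x.2) / (P.1 ^+ 2 + P.2 ^+ 2) * P.2) by [].
rewrite [LHS]surjective_pairing; congr pair.
  apply/(mulIf (lt0r_neq0 n0)); rewrite -mulrAC divfK ?gt_eqF//.
  by have := congr1 (fun z => z * P.2) dPx; lra.
apply/(mulIf (lt0r_neq0 n0)); rewrite -mulrAC divfK ?gt_eqF//.
by have := congr1 (fun z => z * P.1) dPx; lra.
Qed.

(** The covectors Q with <Q, P> = 1 are Q = (P + t J P) / |P|^2 for a real t, J being
the rotation by a quarter turn.  Each point x of K with det(P, x) > 0 bounds t
from above, each y with det(P, y) < 0 bounds it from below.  These bounds are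
compatible, because the segment from x to y meets the line through P at a point
of K, which is not beyond P.  So t can be the supremum of the lower bounds. *)
Lemma boundary_support K P : convex_body K -> boundary K P ->
  exists2 Q, polar K Q & pairing Q P = 1.
Proof.
move=> bK bP.
have n0 := boundary_neq0 bK bP; set n := P.1 ^+ 2 + P.2 ^+ 2 in n0 *.
pose f x := (n - pairing P x) / det P x.
have fle x y : K x -> K y -> 0 < det P x -> det P y < 0 -> f y <= f x.
  move=> Kx Ky a0 b0; set a := det P x in a0; set b := - det P y.
  have {}b0 : 0 < b by rewrite oppr_gt0.
  have ab0 : 0 < a + b by exact: addr_gt0.
  have t01 : 0 <= b / (a + b) <= 1.
    by rewrite divr_ge0 ?(ltW b0) ?(ltW ab0)//= ler_pdivrMr// mul1r lerDr ltW.
  have := boundary_collinear_le bK bP (body_conv bK Kx Ky t01).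
  have -> : 1 - b / (a + b) = a / (a + b) by field; rewrite gt_eqF.
  have -> : det P (b / (a + b) * x.1 + a / (a + b) * y.1,
     b / (a + b) * x.2 + a / (a + b) * y.2) = 0.
    rewrite [LHS](_ : _ = (b * det P x + a * det P y) / (a + b)).
      by rewrite /b /a; ring.
    by rewrite /det /=; field; rewrite gt_eqF.
  move=> /(_ erefl).
  have -> : pairing P (b / (a + b) * x.1 + a / (a + b) * y.1,
     b / (a + b) * x.2 + a / (a + b) * y.2) =
     (b * pairing P x + a * pairing P y) / (a + b).
    by rewrite /pairing /=; field; rewrite gt_eqF.
  rewrite ler_pdivrMr// -/n => le.
  rewrite /f -/a -[det P y]opprK -/b invrN mulrN ler_pdivlMr// mulNr.
  rewrite mulrAC lerNl ler_pdivlMr// mulNr; lra.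
have [r r0 rK] := (interior_box K 0).1 (body_int0 bK).
(* Small multiples of J P and - J P in K bound t on both sides. *)
pose e := r / (`|P.1| + `|P.2| + 1).
have d0 : 0 < `|P.1| + `|P.2| + 1.
  by have := normr_ge0 P.1; have := normr_ge0 P.2; lra.
have e0 : 0 < e by rewrite divr_gt0.
have eP (c a : R) : `|c| = 1 -> `|a| <= `|P.1| + `|P.2| -> `|c * e * a| <= r.
  move=> c1 aP; rewrite -mulrA normrM c1 mul1r normrM (gtr0_norm e0) /e.
  by rewrite mulrAC ler_pdivrMr// ler_wpM2l ?(ltW r0)//; lra.
have Ke (c : R) : `|c| = 1 -> K (c * e * - P.2, c * e * P.1).
  by move=> c1; apply: rK; rewrite /= subr0 eP// ?normrN ?lerDl ?lerDr.
have detJ (c : R) : det P (c * e * - P.2, c * e * P.1) = c * e * n.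
  by rewrite /det /n /=; ring.
have Kp := Ke 1 (normr1 _); have Km := Ke (-1) (normrN1 _).
have detp := detJ 1; have detm := detJ (-1).
pose L := [set f y | y in [set y | K y /\ det P y < 0]].
have ubL x : K x -> 0 < det P x -> ubound L (f x).
  by move=> Kx x0 _ [y [Ky y0] <-]; exact: fle.
have supL : has_sup L.
  split; first by eexists; exists (-1 * e * - P.2, -1 * e * P.1) => //; split => //;
    rewrite detm mulN1r mulNr oppr_lt0 mulr_gt0.
  by eexists; apply: (ubL _ Kp); rewrite detp mul1r mulr_gt0.
pose t := sup L.
have key x : K x -> pairing P x + t * det P x <= n.
  move=> Kx; have [x0|x0|x0] := ltgtP (det P x) 0.
  - have : f x <= t by apply: sup_upper_bound => //; exists x.
    by rewrite /f ler_ndivrMr//; lra.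
  - have : t <= f x by apply: ge_sup; [exact: supL.1|exact: ubL].
    by rewrite /f ler_pdivlMr//; lra.
  - by rewrite x0 mulr0 addr0; exact: (boundary_collinear_le bK bP Kx x0).
exists ((P.1 - t * P.2) / n, (P.2 + t * P.1) / n).
  move=> x Kx; have := key x Kx.
  rewrite -[X in _ <= X]mul1r -ler_pdivrMr//; apply: le_trans.
  by rewrite le_eqVlt /pairing /det /=; apply/orP; left; apply/eqP; ring.
rewrite /pairing /= [LHS](_ : _ = (P.1 ^+ 2 + P.2 ^+ 2) / n); last by ring.
by rewrite divff ?gt_eqF.
Qed.

(** The converse of [boundary_support]. *)
Lemma polar_boundary K P Q : convex_body K -> K P -> polar K Q ->
  pairing Q P = 1 -> boundary K P.
Proof.
move=> bK KP KQ QP; apply/(boundaryP _ bK); split => // c c1 /KQ.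
rewrite [X in X <= _](_ : _ = c * pairing Q P); last by rewrite /pairing /=; ring.
by rewrite QP mulr1 leNgt c1.
Qed.

Lemma pairingC x y : pairing x y = pairing y x.
Proof. by rewrite /pairing; ring. Qed.

Lemma pairing_continuous P : continuous (pairing P : R * R -> R).
Proof. exact: linear_form_continuous. Qed.

Lemma box_compact (M : R) :
  compact [set x : R * R | `|x.1| <= M /\ `|x.2| <= M].
Proof.
rewrite [X in compact X](_ : _ = `[- M, M]%classic `*` `[- M, M]%classic).
  by apply: compact_setX; exact: segment_compact.
by apply/seteqP; split => x /=; rewrite !in_itv/= !ler_norml => -[].
Qed.

Lemma polar_body K : convex_body K -> convex_body (polar K).
Proof.
move=> bK; have [M M0 KM] := body_bounded bK.
have [r r0 rK] := (interior_box K 0).1 (body_int0 bK).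
split.
- apply/convex_setP => x y t Kx Ky /andP[t0 t1] z Kz.
  have := Kx z Kz; have := Ky z Kz; rewrite /pairing /= => yz xz.
  suff : t * (x.1 * z.1 + x.2 * z.2) + (1 - t) * (y.1 * z.1 + y.2 * z.2) <= 1.
    by lra.
  have := ler_wpM2l t0 xz; have := ler_wpM2l (_ : 0 <= 1 - t) yz.
  by rewrite subr_ge0 => /(_ t1); lra.
- apply: subclosed_compact (@box_compact r^-1) _.
    rewrite [X in closed X](_ : _ = \bigcap_(x in K) [set Q | x.1 * Q.1 + x.2 * Q.2 <= 1]).
      by apply: closed_bigI => x _; exact: closed_halfplane.
    by apply/seteqP; split => Q KQ x Kx /=; have := KQ x Kx;
      rewrite /= /pairing; lra.
  move=> Q KQ /=; rewrite !ler_norml.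
  have h (c : R * R) : `|c.1| <= r -> `|c.2| <= r -> pairing Q c <= 1.
    by move=> c1 c2; apply/KQ/rK; rewrite subr0.
  have nr : `|r| <= r by rewrite gtr0_norm.
  have nr' : `|- r| <= r by rewrite normrN gtr0_norm.
  have n0 : `|0 : R| <= r by rewrite normr0 ltW.
  have := h (r, 0) nr n0; have := h (- r, 0) nr' n0.
  have := h (0, r) n0 nr; have := h (0, - r) n0 nr'.
  rewrite /pairing /= !mulr0 !add0r !addr0 !mulrN => h1 h2 h3 h4.
  have le_inv a : a * r <= 1 -> a <= r^-1 by rewrite -[r^-1]mul1r ler_pdivlMr.
  by split; apply/andP; split; rewrite 1?lerNl; apply: le_inv; rewrite ?mulNr.
- apply/interior_box; exists (2 * M)^-1; first by rewrite invr_gt0 mulr_gt0.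
  move=> Q /=; rewrite !subr0 => Q1 Q2 x /KM[x1 x2].
  have h (a b : R) : `|a| <= (2 * M)^-1 -> `|b| <= M -> a * b <= 1 / 2.
    move=> aM bM; rewrite (le_trans (ler_norm _))// normrM.
    rewrite (_ : 1 / 2 = (2 * M)^-1 * M); last by field; rewrite gt_eqF.
    exact: ler_pM.
  by have := h _ _ Q1 x1; have := h _ _ Q2 x2; rewrite /pairing; lra.
Qed.

Lemma boundary_ray K u : convex_body K -> u != 0 ->
  exists2 c, 0 < c & boundary K (c * u.1, c * u.2).
Proof.
move=> bK u0; have [M M0 KM] := body_bounded bK.
have [r r0 rK] := (interior_box K 0).1 (body_int0 bK).
have d0 : 0 < `|u.1| + `|u.2|.
  rewrite lt_neqAle addr_ge0 ?normr_ge0// andbT eq_sym paddr_eq0 ?normr_ge0//.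
  by rewrite !normr_eq0; apply: contra u0 => /andP[/eqP u1 /eqP u2];
    rewrite [u]surjective_pairing u1 u2.
pose A := [set c | 0 <= c /\ K (c * u.1, c * u.2)].
have cA : compact A.
  apply: (subclosed_compact _ (@segment_compact R 0 (2 * M / (`|u.1| + `|u.2|)))).
    rewrite [A](_ : _ = [set c | 0 <= c] `&` (fun c => (c * u.1, c * u.2)) @^-1` K)//.
    apply: closedI; first exact: closed_ge.
    have /continuous_closedP : continuous (fun c : R => (c * u.1, c * u.2)).
      by move=> c; apply: (cvg_pair (G := nbhs (c * u.1)) (H := nbhs (c * u.2)));
        apply: cvgM; [exact: cvg_id|exact: cvg_cst|exact: cvg_id|exact: cvg_cst].
    by move=> /(_ K (body_closed bK)).
  move=> c [c0 /KM/= []]; rewrite !normrM ger0_norm// => c1 c2.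
  by rewrite /= in_itv/= c0 ler_pdivlMr// mulrDr; lra.
have As : A (r / (`|u.1| + `|u.2|)).
  have sm (a : R) : `|a| <= `|u.1| + `|u.2| ->
      `|r / (`|u.1| + `|u.2|) * a| <= r.
    move=> aP; rewrite normrM (gtr0_norm (divr_gt0 r0 d0)).
    by rewrite mulrAC ler_pdivrMr// ler_wpM2l ?(ltW r0).
  split; first by rewrite divr_ge0// ltW.
  by apply: rK; rewrite /= subr0 sm// ?lerDl ?lerDr.
have [||c /set_mem[c0 Kc] cmax] := @compact_EVT_max _ _ id A _ cA.
- by exists (r / (`|u.1| + `|u.2|)).
- by apply: continuous_subspaceT => c; exact: cvg_id.
have {}c0 : 0 < c.
  by rewrite (lt_le_trans _ (cmax _ (mem_set As)))// divr_gt0.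
exists c => //; apply/(boundaryP _ bK); split => //= d d1 Kd.
have /mem_set/cmax : A (d * c).
  by split; [rewrite mulr_ge0// ltW// (lt_trans _ d1)|rewrite -!mulrA].
by rewrite leNgt ltr_pMl ?d1.
Qed.

Lemma boundary_ray_inj K P c : convex_body K -> 0 < c ->
  boundary K P -> boundary K (c * P.1, c * P.2) -> c = 1.
Proof.
move=> bK c0 /(boundaryP _ bK)[KP nP] /(boundaryP _ bK)[KcP ncP].
have [c1|c1|//] := ltgtP c 1; last by case: (nP c).
exfalso; apply: (ncP c^-1) => /=; first by rewrite invf_gt1.
by rewrite !mulKf ?gt_eqF// -surjective_pairing.
Qed.

(** A point x outside K is beyond the boundary point on its ray, and a covector
supporting K there takes a value above 1 at x. *)
Lemma bipolar K : convex_body K -> polar (polar K) = K.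
Proof.
move=> bK; apply/seteqP; split => [x KKx|x Kx q Kq]; last first.
  by rewrite pairingC; exact: Kq.
have [->|x0] := eqVneq x 0; first exact: body0.
have [c c0 bc] := boundary_ray bK x0.
have [Q KQ /= QP] := boundary_support bK bc.
have c1 : 1 <= c.
  have := KKx Q KQ; rewrite pairingC => Qx.
  rewrite -QP (_ : pairing Q _ = c * pairing Q x); last by rewrite /pairing/=; ring.
  by rewrite ler_piMr// ltW.
have [Kc _] := (boundaryP _ bK).1 bc.
have := @body_shrink _ _ c^-1 bK Kc.
rewrite /= !mulKf ?gt_eqF// -surjective_pairing; apply.
by rewrite invr_ge0 ltW//= invf_le1.
Qed.

End ConvexBody.

(** * Plane Lebesgue measure and linear maps *)

Section Area.
Context {R : realType}.
Local Notation RM := (measurableTypeR R).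
Local Notation mu1 := (@lebesgue_measure R).
Local Notation mu2 := (@lebesgue_measure R \x @lebesgue_measure R)%E.
Implicit Types A : set (RM * RM).

Let affine (c d : R) : RM -> RM := fun y => c + d * y.

Let measurable_affine c d : measurable_fun setT (affine c d).
Proof.
apply: measurable_funD; first exact: measurable_cst.
by apply: measurable_funM; [exact: measurable_cst|exact: measurable_id].
Qed.


Lemma lebesgue_measure_affine (c d : R) (B : set RM) : d != 0 -> measurable B ->
  mu1 ((fun y => c + d * y) @^-1` B) = (`|d|^-1%:E * mu1 B)%E.
Proof.
move=> d0 mB; have nd0 : 0 < `|d| by rewrite normr_gt0.
have h : forall X, ocitv X ->
    mu1 X = mscale (NngNum (ltW nd0)) (pushforward mu1 (affine c d)) X.
  move=> mf _ [[a b]] _ <-; rewrite /mscale /pushforward /=.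
  rewrite lebesgue_measure_itv /= lte_fin /pushforward.
  have [d1|d1|d1] := ltgtP d 0; last by rewrite d1 eqxx in d0.
    rewrite [X in lebesgue_measure X](_ : _ = `[(b - c) / d, (a - c) / d[%classic); last first.
      apply/seteqP; split => y; rewrite /affine /= !in_itv /=;
        by rewrite ler_ndivrMr// ltr_ndivlMr//; lra.
    rewrite lebesgue_measure_itv /= lte_fin ltr_nM2r ?invr_lt0// ltrD2r.
    case: ifPn => _; last by rewrite mule0.
    by rewrite -!EFinD -EFinM ltr0_norm//; congr EFin; field; rewrite lt_eqF.
  rewrite [X in lebesgue_measure X](_ : _ = `](a - c) / d, (b - c) / d]%classic); last first.
    apply/seteqP; split => y; rewrite /affine /= !in_itv /=;
      by rewrite ler_pdivlMr// ltr_pdivrMr//; lra.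
  rewrite lebesgue_measure_itv /= lte_fin ltr_pM2r ?invr_gt0// ltrD2r.
  case: ifPn => _; last by rewrite mule0.
  by rewrite -!EFinD -EFinM gtr0_norm//; congr EFin; field; rewrite gt_eqF.
rewrite (lebesgue_measure_unique (h (measurable_affine c d)) mB).
rewrite /mscale /pushforward /=.
by rewrite muleA -EFinM mulVf ?mul1e// gt_eqF.
Qed.

Definition linear_map (a b c d : R) (p : RM * RM) : RM * RM :=
  (a * p.1 + b * p.2, c * p.1 + d * p.2).

Lemma measurable_linear_form (a b : R) :
  measurable_fun setT (fun p : RM * RM => a * p.1 + b * p.2).
Proof.
apply: measurable_funD.
  by apply: measurable_funM; [exact: measurable_cst|exact: measurable_fst].
by apply: measurable_funM; [exact: measurable_cst|exact: measurable_snd].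
Qed.

Lemma measurable_linear_map a b c d : measurable_fun setT (linear_map a b c d).
Proof. by apply: measurable_fun_pair; exact: measurable_linear_form. Qed.

Lemma measurable_preimage_linear a b c d A : measurable A ->
  measurable (linear_map a b c d @^-1` A).
Proof. by move=> mA; rewrite -[X in measurable X]setTI; exact: measurable_linear_map. Qed.

Lemma area_swap A : measurable A -> mu2 (linear_map 0 1 1 0 @^-1` A) = mu2 A.
Proof.
move=> mA.
rewrite (_ : _ @^-1` A = (fun p : RM * RM => (p.2, p.1)) @^-1` A); last first.
  by apply/seteqP; split => p; rewrite /linear_map /= !mul0r !mul1r addr0 add0r.
rewrite [RHS](@product_measure_unique _ _ _ _ _ mu1 mu1 (mu1 \x^ mu1)%E)//.
by move=> B C mB mC; exact: product_measure2E.
Qed.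

(** By Fubini: on each vertical line the map is affine in one variable. *)
Lemma area_shear (c d : R) A : d != 0 -> measurable A ->
  mu2 (linear_map 1 0 c d @^-1` A) = (`|d|^-1%:E * mu2 A)%E.
Proof.
move=> d0 mA; rewrite /product_measure1 -ge0_integralZl//=; last first.
  exact: measurable_fun_xsection.
apply: eq_integral => x _ /=.
rewrite -(lebesgue_measure_affine (c * x) d0)//; last exact: measurable_xsection.
congr (lebesgue_measure _); apply/seteqP; split => y;
  by rewrite /xsection /= !inE /linear_map /= mul1r mul0r addr0.
Qed.

(** When d is not 0, the map is a product of two shears and two exchanges of the
coordinates; when d = 0, exchange the two coordinates of the image first. *)
Lemma area_linear (a b c d : R) A : a * d - b * c != 0 -> measurable A ->
  mu2 (linear_map a b c d @^-1` A) = (`|a * d - b * c|^-1%:E * mu2 A)%E.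
Proof.
move=> + mA; wlog d0 : a b c d A mA / d != 0 => [wl|n0].
  have [->|d0] := eqVneq d 0; last by move=> n0; apply: wl.
  rewrite mulr0 sub0r oppr_eq0 => bc.
  have b0 : b != 0 by apply: contra bc => /eqP ->; rewrite mul0r.
  have := wl c 0 a b _ (measurable_preimage_linear 0 1 1 0 mA) b0.
  rewrite mul0r subr0 [c * b]mulrC (area_swap mA) normrN => /(_ bc) <-.
  congr mu2; apply/seteqP; split => p; rewrite /linear_map /=;
  by rewrite !(mul0r, mul1r, addr0, add0r).
have -> : linear_map a b c d = linear_map 0 1 1 0 \o (linear_map 1 0 (b / d)
    (a - b * c / d) \o (linear_map 0 1 1 0 \o linear_map 1 0 c d)).
  by apply/funext => p; rewrite /linear_map /=; congr pair; field.
rewrite !comp_preimage.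
have e0 : a - b * c / d != 0.
  apply: contra n0 => /eqP e; apply/eqP; rewrite [LHS](_ : _ = (a - b * c / d) * d).
    by rewrite e mul0r.
  by field.
have m1 := measurable_preimage_linear 0 1 1 0 mA.
have m2 := measurable_preimage_linear 1 0 (b / d) (a - b * c / d) m1.
have m3 := measurable_preimage_linear 0 1 1 0 m2.
rewrite area_shear// area_swap// area_shear// area_swap// muleA -EFinM.
by rewrite -invfM -normrM; congr ((`|_|^-1)%:E * _)%E; field.
Qed.

End Area.

(** * Area of triangles *)

Section Triangle.
Context {R : realType}.
Local Notation RM := (measurableTypeR R).
Local Notation mu1 := (@lebesgue_measure R).
Local Notation mu2 := (@lebesgue_measure R \x @lebesgue_measure R)%E.
Local Notation plane := (RM * RM)%type.
Implicit Types (A : set plane) (u v x : R * R).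

(** An open set is the union of the rational boxes that it contains. *)
Lemma open_measurable_plane (U : set (R * R)) : open U ->
  measurable (U : set plane).
Proof.
move=> oU.
pose B (i : (rat * rat) * (rat * rat)) : set plane :=
  `]ratr i.1.1, ratr i.1.2[%classic `*` `]ratr i.2.1, ratr i.2.2[%classic.
pose F i : set plane := if `[<B i `<=` U>] then B i else set0.
have -> : (U : set plane) = \bigcup_i F i.
  apply/seteqP; split => [x Ux|x [i _]]; last first.
    by rewrite /F; case: ifPn => // /asboolP; exact.
  have : nbhs x U by exact: open_nbhs_nbhs.
  move=> /nbhs_ballP[e /= e0 eU].
  have itv (a : R) : exists q : rat * rat,
      [/\ a - e < ratr q.1, ratr q.1 < a, a < ratr q.2 & ratr q.2 < a + e].
    have [p] := @rat_in_itvoo R (a - e) a ltac:(lra).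
    have [q] := @rat_in_itvoo R a (a + e) ltac:(lra).
    rewrite !in_itv /= => /andP[q1 q2] /andP[p1 p2].
    by exists (p, q).
  have [p [p1 p2 p3 p4]] := itv x.1; have [q [q1 q2 q3 q4]] := itv x.2.
  exists (p, q) => //; rewrite /F; case: ifPn => [_|/asboolP[]].
    by split; rewrite /= in_itv /= ?p2 ?q2.
  move=> y [/=]; rewrite !in_itv /= => /andP[y1 y2] /andP[y3 y4].
  apply: eU; split; rewrite /ball /= ltr_norml; lra.
apply: countable_bigcupT_measurable; first exact: countableP.
move=> i; rewrite /F; case: ifPn => // _.
by apply: measurableX; exact: measurable_itv.
Qed.

Lemma closed_measurable_plane (U : set (R * R)) : closed U ->
  measurable (U : set plane).
Proof.
move=> /closed_openC/open_measurable_plane mU.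
by rewrite -[U]setCK; exact: measurableC mU.
Qed.

Lemma closed_det_ge0 u : closed [set x | 0 <= det u x].
Proof.
rewrite [X in closed X](_ : _ = [set x | u.2 * x.1 + - u.1 * x.2 <= 0]).
  exact: closed_halfplane.
by apply/seteqP; split => x /=; rewrite /det; lra.
Qed.

Lemma detC u v : det u v = - det v u.
Proof. by rewrite /det; ring. Qed.

(** A linear map of determinant |u|^2 sends the line to the first coordinate axis. *)
Lemma area_line u : u != 0 -> mu2 [set x | det u x = 0] = 0%E.
Proof.
move=> u0.
have n0 : u.1 * u.1 - u.2 * (- u.2) != 0.
  rewrite mulrN opprK -!expr2 paddr_eq0 ?sqr_ge0// !sqrf_eq0.
  apply: contra u0 => /andP[/eqP u1 /eqP u2].
  by rewrite [u]surjective_pairing u1 u2.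
have m0 : measurable ([set: RM] `*` [set (0 : R)]).
  by apply: measurableX; [exact: measurableT|exact: measurable_set1].
have := area_linear n0 m0.
rewrite product_measure1E//= lebesgue_measure_set1 !mule0 => <-; congr mu2.
by apply/seteqP; split => x /=; rewrite /linear_map /det /=; [split => //; lra|case=> _ /=; lra].
Qed.

(** By Cramer's rule, det x v / det u v and det u x / det u v are the coordinates of x
in the basis (u, v).  So, when det u v is positive, this is the convex hull of 0,
u and v. *)
Definition triangle u v : set plane :=
  [set x | [/\ 0 <= det u x, 0 <= det x v & det u x + det x v <= det u v]].

Lemma closed_triangle u v : closed (triangle u v : set (R * R)).
Proof.
rewrite (_ : triangle u v = [set x | 0 <= det u x] `&` [set x | 0 <= det (- v) x]
    `&` [set x | (v.2 - u.2) * x.1 + (u.1 - v.1) * x.2 <= det u v]).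
  by apply: closedI; [apply: closedI; exact: closed_det_ge0|exact: closed_halfplane].
apply/seteqP; split => x; rewrite /triangle /det /=.
  by move=> [x1 x2 x3]; split; [split|]; lra.
by move=> [[x1 x2] x3]; split; lra.
Qed.

Lemma measurable_triangle u v : measurable (triangle u v).
Proof. exact: (closed_measurable_plane (@closed_triangle u v)). Qed.

Let std : set plane := triangle (1, 0) (0, 1).

Lemma area_triangle_std u v : 0 < det u v ->
  mu2 (triangle u v) = ((det u v)%:E * mu2 std)%E.
Proof.
move=> D0; set D := det u v in D0 *.
have e : v.2 / D * (u.1 / D) - (- v.1 / D) * (- u.2 / D) = D^-1.
  rewrite [LHS](_ : _ = det u v * (D^-1 * D^-1)); last by rewrite /det; ring.
  by rewrite -/D mulVKf ?gt_eqF.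
have ne : v.2 / D * (u.1 / D) - (- v.1 / D) * (- u.2 / D) != 0.
  by rewrite e invr_eq0 gt_eqF.
have mstd : measurable std := measurable_triangle _ _.
have := area_linear ne mstd.
have -> : `|v.2 / D * (u.1 / D) - (- v.1 / D) * (- u.2 / D)|^-1 = D.
  by rewrite e normfV invrK gtr0_norm.
move=> <-.
have stdE y : std y = [/\ 0 <= y.2, 0 <= y.1 & y.2 + y.1 <= 1].
  rewrite /std /triangle /det /=.
  by rewrite !(mul0r, mulr0, mul1r, mulr1, subr0, oppr0).
congr mu2; apply/funext => x; rewrite /preimage /= stdE /linear_map /triangle /=.
have -> : v.2 / D * x.1 + - v.1 / D * x.2 = det x v / D by rewrite /det; ring.
have -> : - u.2 / D * x.1 + u.1 / D * x.2 = det u x / D by rewrite /det; ring.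
rewrite !pmulr_lge0 ?invr_gt0// -mulrDl ler_pdivrMr// mul1r.
by rewrite /D.
Qed.

Lemma area_unit_square : mu2 (`[0, 1]%classic `*` `[0, 1]%classic) = 1%E.
Proof.
rewrite product_measure1E//=; [|exact: measurable_itv..].
by rewrite !lebesgue_measure_itv/= lte_fin ltr01 sube0 mule1.
Qed.

(** The diagonal cuts the unit square into two triangles of determinant 1, and all
triangles of determinant 1 have the same area. *)
Lemma area_triangle u v : 0 < det u v ->
  mu2 (triangle u v) = (det u v / 2)%:E.
Proof.
move=> /area_triangle_std ->.
suff -> : mu2 std = (2^-1)%:E by [].
have d1 : det (1, 0 : R) (1, 1) = 1 by rewrite /det /=; lra.
have d2 : det (1 : R, 1 : R) (0, 1) = 1 by rewrite /det /=; lra.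
have A1 : mu2 (triangle (1, 0) (1, 1)) = mu2 std.
  by have := @area_triangle_std (1, 0) (1, 1); rewrite d1 mul1e; apply.
have A2 : mu2 (triangle (1, 1) (0, 1)) = mu2 std.
  by have := @area_triangle_std (1, 1) (0, 1); rewrite d2 mul1e; apply.
have m1 := measurable_triangle (1, 0) (1, 1).
have m2 := measurable_triangle (1, 1) (0, 1).
have sqE : `[0, 1]%classic `*` `[0, 1]%classic =
    triangle (1, 0) (1, 1) `|` triangle (1, 1) (0, 1).
  apply/seteqP; split => x; rewrite /triangle /det /= !in_itv /=.
    move=> [/andP[x1 x2] /andP[x3 x4]].
    by have [x12|x12] := leP x.2 x.1; [left|right]; split; lra.
  by move=> [[x1 x2 x3]|[x1 x2 x3]]; split; lra.
have I0 : mu2 (triangle (1, 0) (1, 1) `&` triangle (1, 1) (0, 1)) = 0%E.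
  apply: (@subset_measure0 _ _ _ mu2 _ [set x | det (1, 1) x = 0]).
  - exact: measurableI.
  - apply: closed_measurable_plane.
    rewrite [X in closed X](_ : _ = [set x | 0 <= det (1, 1) x] `&` [set x | 0 <= det (-1, -1) x]).
      by apply: closedI; exact: closed_det_ge0.
    by apply/seteqP; split => x; rewrite /det /=; [move=> ?; split|case]; lra.
  - by move=> x [[x1 x2 x3] [y1 y2 y3]]; move: x1 x2 x3 y1 y2 y3; rewrite /det /=; lra.
  - by apply: area_line; apply/eqP => -[/eqP]; rewrite oner_eq0.
have fin : (mu2 (triangle (1%R, 0%R) (1%R, 1%R)) < +oo)%E.
  apply: (@le_lt_trans _ _ 1%E); last exact: ltry.
  rewrite -area_unit_square sqE.
  by apply: (le_measure mu2); rewrite ?inE; [|exact: measurableU|exact: subsetUl].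
have := area_unit_square; rewrite sqE.
have -> : mu2 (triangle (1, 0) (1, 1) `|` triangle (1, 1) (0, 1)) =
    (mu2 (triangle (1%R, 0%R) (1%R, 1%R)) + mu2 (triangle (1%R, 1%R) (0%R, 1%R))
     - mu2 (triangle (1%R, 0%R) (1%R, 1%R) `&` triangle (1%R, 1%R) (0%R, 1%R)))%E.
  exact: measureUfinl.
rewrite I0 sube0 A1 A2; rewrite A1 in fin.
have fin_std : mu2 std \is a fin_num by rewrite ge0_fin_numE.
by rewrite -(fineK fin_std) -EFinD => -[h]; congr EFin; lra.
Qed.

End Triangle.

(** * Rays and cones *)

Lemma modR_itv (R : realType) (p t : R) : 0 < p -> 0 <= modR p t < p.
Proof.
move=> p0; have := floor_itv (t / p); rewrite /modR.
by rewrite ler_pdivlMr// ltr_pdivrMr// intrD mulrDl mul1r; lra.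
Qed.

Section Angles.
Context {R : realType}.
Implicit Types (K : set (R * R)) (a b s t : R) (x P : R * R).

Definition dir t : R * R := (cos t, sin t).

Lemma det_dir a b : det (dir a) (dir b) = sin (b - a).
Proof. by rewrite /det /dir /= sinB; ring. Qed.

Lemma dir_neq0 t : dir t != 0.
Proof.
apply/eqP => -[c0 s0]; have := cos2Dsin2 t; rewrite c0 s0 expr0n /= addr0.
by move/eqP; rewrite eq_sym oner_eq0.
Qed.

Lemma dirDnat t n : dir (t + n%:R * (2 * pi)) = dir t.
Proof.
have -> : n%:R * (2 * pi) = pi *+ 2 *+ n :> R by rewrite !mulr_natl.
by rewrite /dir (periodicn (@cosD2pi R)) (periodicn (@sinD2pi R)).
Qed.

Lemma dirD2pi t : dir (t + 2 * pi) = dir t.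
Proof. by have := dirDnat t 1; rewrite mul1r. Qed.

Lemma dirDint t (z : int) : dir (t + z%:~R * (2 * pi)) = dir t.
Proof.
case: z => n; first by rewrite -pmulrn dirDnat.
by rewrite -(dirDnat (t + _) n.+1) NegzE mulrNz mulNr -pmulrn subrK.
Qed.

Lemma rayP t x : ray t x <-> exists2 r, 0 <= r & x = (r * (dir t).1, r * (dir t).2).
Proof. by split=> [[r r0 <-]|[r r0 ->]]; exists r. Qed.

Lemma eq_ray s t : dir s = dir t -> ray s = ray t :> set (R * R).
Proof.
by move=> e; apply/seteqP; split => x /rayP[r r0 ->]; apply/rayP; exists r => //;
  rewrite e.
Qed.

Lemma cos_lt1 s : 0 < s < 2 * pi -> cos s < 1.
Proof.
move=> /andP[s0 s2]; have -> : s = (s / 2) *+ 2 by rewrite -mulr_natr; field.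
rewrite cos_mulr2n; have h : 0 < sin (s / 2) by apply: sin_gt0_pi; lra.
have := cos2Dsin2 (s / 2); have := exprn_gt0 2 h; lra.
Qed.

Lemma ray_inter s t x : s <= t <= s + 2 * pi -> ray s x -> ray t x -> x != 0 ->
  t = s \/ t = s + 2 * pi.
Proof.
move=> /andP[st ts] [r /= r0 <-] [r' /= r'0 [e1 e2]] xn0.
have rr : r' = r.
  apply/eqP; rewrite -(@eqrXn2 _ 2)//; apply/eqP.
  have -> : r ^+ 2 = r ^+ 2 * (cos s ^+ 2 + sin s ^+ 2) by rewrite cos2Dsin2 mulr1.
  have -> : r' ^+ 2 = r' ^+ 2 * (cos t ^+ 2 + sin t ^+ 2) by rewrite cos2Dsin2 mulr1.
  by rewrite !mulrDr -!exprMn e1 e2.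
subst r'.
have {}rn0 : r != 0 by apply: contra xn0 => /eqP ->; rewrite !mul0r.
have c1 : cos (t - s) = 1.
  by rewrite cosB (mulfI rn0 e1) (mulfI rn0 e2) -!expr2 cos2Dsin2.
have [->|nst] := eqVneq t s; [by left|right].
apply/eqP; rewrite eq_le ts leNgt; apply/negP => lt.
have : cos (t - s) < 1 by apply: cos_lt1; rewrite subr_gt0 lt_neqAle eq_sym nst st /=; lra.
by rewrite c1 ltxx.
Qed.

Lemma ray0 t : ray t (0 : R * R).
Proof. by exists 0; rewrite /= ?mul0r. Qed.

(** The principal angle comes from [acos]; reducing it modulo a full turn brings it
into the half-open turn that starts at a. *)
Lemma polar_coord a x : exists t, a <= t < a + 2 * pi /\ ray t x.
Proof.
have p0 : 0 < 2 * pi :> R by rewrite mulr_gt0// pi_gt0.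
suff [t tx] : exists t, ray t x.
  exists (a + modR (2 * pi) (t - a)); split.
    by have := modR_itv (t - a) p0; lra.
  rewrite (_ : ray _ = ray t)//; apply: eq_ray; rewrite /modR.
  set z := Num.floor _; rewrite -[RHS](dirDint t (- z)) mulrNz mulNr.
  by congr dir; ring.
have [->|x0] := eqVneq x 0; first by exists 0; exact: ray0.
pose r := Num.sqrt (x.1 ^+ 2 + x.2 ^+ 2).
have n0 : 0 < x.1 ^+ 2 + x.2 ^+ 2.
  rewrite lt_neqAle addr_ge0 ?sqr_ge0// andbT eq_sym paddr_eq0 ?sqr_ge0// !sqrf_eq0.
  apply: contra x0 => /andP[/eqP x1 /eqP x2].
  by rewrite [x]surjective_pairing x1 x2.
have r0 : 0 < r by rewrite sqrtr_gt0.
have r2 : r ^+ 2 = x.1 ^+ 2 + x.2 ^+ 2 by rewrite sqr_sqrtr// ltW.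
have c1 : -1 <= x.1 / r <= 1.
  rewrite -ler_norml normrM normfV (gtr0_norm r0) ler_pdivrMr// mul1r.
  by rewrite -(@ler_pXn2r _ 2) ?nnegrE ?normr_ge0 ?(ltW r0)// r2 real_normK ?num_real// lerDl sqr_ge0.
have sE : sin (acos (x.1 / r)) = `|x.2| / r.
  rewrite sin_acos//; have -> : 1 - (x.1 / r) ^+ 2 = (x.2 / r) ^+ 2.
    rewrite !expr_div_n; apply: (@mulIf _ (r ^+ 2)); first by rewrite expf_neq0// gt_eqF.
    by rewrite mulrBl !divfK ?expf_neq0 ?gt_eqF// r2; ring.
  by rewrite sqrtr_sqr normrM normfV (gtr0_norm r0).
have cE : cos (acos (x.1 / r)) = x.1 / r by rewrite acosK// in_itv.
have [x2|x2] := leP 0 x.2.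
  exists (acos (x.1 / r)), r; first exact: ltW.
  by rewrite sE cE ger0_norm// ![r * _]mulrC !divfK ?gt_eqF// -surjective_pairing.
exists (- acos (x.1 / r)), r; first exact: ltW.
rewrite sinN cosN sE cE ltr0_norm// mulNr opprK ![r * _]mulrC !divfK ?gt_eqF//.
by rewrite -surjective_pairing.
Qed.

Definition cone a b : set (R * R) := \bigcup_(t in [set t | a <= t <= b]) ray t.

Lemma coneU a b c : a <= b <= c -> cone a c = cone a b `|` cone b c.
Proof.
move=> /andP[ab bc]; apply/seteqP; split => x.
  move=> [t /= /andP[at_ tc] tx]; have [tb|bt] := leP t b.
    by left; exists t => //=; rewrite at_.
  by right; exists t => //=; rewrite (ltW bt).
by move=> [] [t /= /andP[t1 t2] tx]; exists t => //=; lra.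
Qed.

Lemma cone_full a : cone a (a + 2 * pi) = setT.
Proof.
apply/seteqP; split => // x _; have [t [/andP[t1 t2] tx]] := polar_coord a x.
by exists t => //=; rewrite t1 ltW.
Qed.

Lemma coneD2pi a b : cone (a + 2 * pi) (b + 2 * pi) = cone a b.
Proof.
apply/seteqP; split => x [t /= t1 tx].
  exists (t - 2 * pi); first by rewrite /=; lra.
  by rewrite (@eq_ray _ t)// -dirD2pi subrK.
exists (t + 2 * pi); first by rewrite /=; lra.
by rewrite (@eq_ray _ t)// dirD2pi.
Qed.

Lemma cone1 a : cone a a = ray a.
Proof.
apply/seteqP; split => [x [t /= t1 tx]|x ax]; last by exists a; rewrite //= lexx.
by rewrite (_ : a = t)//; apply/eqP; rewrite eq_le.
Qed.

Lemma det_ray a r x : det (r * (dir a).1, r * (dir a).2) x = r * det (dir a) x.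
Proof. by rewrite /det /=; ring. Qed.

Lemma det_rayr a r x : det x (r * (dir a).1, r * (dir a).2) = r * det x (dir a).
Proof. by rewrite /det /=; ring. Qed.

(** Only for an angle smaller than pi, where the cone is convex. *)
Lemma convex_coneE a b : a < b < a + pi ->
  cone a b = [set x | 0 <= det (dir a) x /\ 0 <= det x (dir b)].
Proof.
move=> /andP[ab ba]; apply/seteqP; split => x.
  move=> [t /= /andP[at_ tb] /rayP[r r0 ->]]; rewrite det_ray det_rayr !det_dir.
  by split; apply: mulr_ge0 => //; apply: sin_ge0_pi; lra.
move=> /= [x1 x2]; have [t [/andP[at_ ta] tx]] := polar_coord a x.
have [->|xn0] := eqVneq x 0.
  by exists a; [rewrite /= lexx ltW|exact: ray0].
move: tx x1 x2 xn0 => /rayP[r r0 ->].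
rewrite det_ray det_rayr !det_dir => x1 x2 xn0.
have {}r0 : 0 < r.
  rewrite lt_neqAle r0 andbT; apply: contra xn0 => /eqP <-.
  by rewrite !mul0r.
rewrite !pmulr_rge0// in x1 x2.
exists t; last by apply/rayP; exists r => //; exact: ltW.
rewrite /= at_ leNgt; apply/negP => bt.
have [tp|tp] := ltP t (b + pi).
  have : 0 < sin (t - b) by apply: sin_gt0_pi; lra.
  by rewrite -opprB sinN; lra.
have : 0 < sin (t - a - pi) by apply: sin_gt0_pi; lra.
rewrite -[t - a - pi]opprB sinN.
have -> : pi - (t - a) = - (t - a) + pi by ring.
by rewrite sinDpi sinN; lra.
Qed.

End Angles.

(** * Areas swept in a convex body *)

Section Wedge.
Context {R : realType} (K : set (R * R)).
Hypothesis bK : convex_body K.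
Local Notation RM := (measurableTypeR R).
Local Notation mu2 := (@lebesgue_measure R \x @lebesgue_measure R)%E.
Local Notation plane := (RM * RM)%type.
Implicit Types (a b c t : R) (x P Q U V : R * R).

Definition wedge a b : set plane := K `&` cone a b.

Lemma closed_cone a b : a <= b < a + pi -> closed (cone a b : set (R * R)).
Proof.
move=> /andP[]; rewrite le_eqVlt => /predU1P[<- _|ab ba].
  rewrite cone1 (_ : ray a = [set x | 0 <= det (dir a) x] `&`
    [set x | 0 <= det (- (dir a).1, - (dir a).2) x] `&`
    [set x | - cos a * x.1 + - sin a * x.2 <= 0]).
    apply: closedI; last exact: closed_halfplane.
    by apply: closedI; exact: closed_det_ge0.
  apply/seteqP; split => x.
    move=> /rayP[r r0 ->] /=; rewrite !det_rayr det_dir subrr sin0 mulr0.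
    rewrite /det /dir /=; split; [split|]; [by []|lra|].
    rewrite (_ : _ + _ = - (r * (cos a ^+ 2 + sin a ^+ 2))); last by ring.
    by rewrite cos2Dsin2 mulr1 oppr_le0.
  rewrite /det /dir /= => -[[x1 x2] x3].
  have e : cos a * x.2 = sin a * x.1 by lra.
  apply/rayP; exists (cos a * x.1 + sin a * x.2) => /=; first by lra.
  have cs := cos2Dsin2 a; rewrite [LHS]surjective_pairing; congr pair.
    by rewrite -[LHS]mul1r -cs; have := congr1 (fun z => z * sin a) e; lra.
  by rewrite -[LHS]mul1r -cs; have := congr1 (fun z => z * cos a) e; lra.
rewrite convex_coneE ?ab// [X in closed X](_ : _ = [set x | 0 <= det (dir a) x] `&`
    [set x | 0 <= det (- (dir b).1, - (dir b).2) x]).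
  by apply: closedI; exact: closed_det_ge0.
by apply/seteqP; split => x; rewrite /det /=; move=> [x1 x2]; split; lra.
Qed.

(** Cutting the angle into three leaves convex cones, which are closed. *)
Lemma measurable_wedge a b : a <= b <= a + 2 * pi -> measurable (wedge a b).
Proof.
move=> /andP[ab ba]; have p0 := pi_gt0 R.
have closedW c d : c <= d < c + pi -> measurable (wedge c d).
  move=> cd; apply: closed_measurable_plane.
  by apply: closedI; [exact: body_closed|exact: closed_cone].
pose d := (b - a) / 3.
have -> : wedge a b = wedge a (a + d) `|` (wedge (a + d) (a + 2 * d) `|` wedge (a + 2 * d) b).
  rewrite /wedge -!setIUr -!coneU//; rewrite /d; lra.
by apply: measurableU; [|apply: measurableU]; apply: closedW; rewrite /d; lra.
Qed.

Lemma body_mu_fin : (mu2 K < +oo)%E.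
Proof.
have [M M0 KM] := body_bounded bK.
apply: (@le_lt_trans _ _ (mu2 (`[- M, M]%classic `*` `[- M, M]%classic))).
  apply: (le_measure mu2); rewrite ?inE.
  - exact: (closed_measurable_plane (body_closed bK)).
  - by apply: measurableX; exact: measurable_itv.
  - by move=> x /KM[]; rewrite !ler_norml => x1 x2; split; rewrite /= in_itv.
rewrite product_measure1E//=; [|exact: measurable_itv..].
by rewrite !lebesgue_measure_itv/=; case: ifPn => _; rewrite ?mul0e// -?EFinD -?EFinM ltry.
Qed.

Lemma le_area (A B : set plane) : measurable A -> measurable B -> A `<=` B ->
  (mu2 B < +oo)%E -> area A <= area B.
Proof.
move=> mA mB AB Bfin; have leAB : (mu2 A <= mu2 B)%E by apply: (le_measure mu2); rewrite ?inE.
apply: fine_le => //; rewrite ge0_fin_numE//; exact: le_lt_trans Bfin.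
Qed.

Lemma wedge_mu_fin a b : a <= b <= a + 2 * pi -> (mu2 (wedge a b) < +oo)%E.
Proof.
move=> ab; apply: le_lt_trans body_mu_fin; apply: (le_measure mu2); rewrite ?inE.
- exact: measurable_wedge.
- exact: (closed_measurable_plane (body_closed bK)).
- by move=> x [].
Qed.

Definition warea a b := area (wedge a b).

Lemma sector_area a : area (sector K a) = warea 0 a.
Proof. by []. Qed.

Lemma warea_ge0 a b : 0 <= warea a b.
Proof. exact: fine_ge0. Qed.

Lemma warea_full a : warea a (a + 2 * pi) = area K.
Proof. by rewrite /warea /wedge cone_full setIT. Qed.

Lemma wareaD2pi a b : warea (a + 2 * pi) (b + 2 * pi) = warea a b.
Proof. by rewrite /warea /wedge coneD2pi. Qed.

Lemma measurable_line a : measurable ([set x | det (dir a) x = 0] : set plane).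
Proof.
apply: closed_measurable_plane.
rewrite [X in closed X](_ : _ = [set x | 0 <= det (dir a) x] `&`
    [set x | 0 <= det (- (dir a).1, - (dir a).2) x]).
  by apply: closedI; exact: closed_det_ge0.
by apply/seteqP; split => x; rewrite /det /=; [move=> ?; split|case]; lra.
Qed.

(** The two wedges meet only on the ray b and, when c = a + 2 pi, on the ray a as well;
lines have area 0. *)
Lemma warea_add a b c : a <= b <= c -> c <= a + 2 * pi ->
  warea a c = warea a b + warea b c.
Proof.
move=> /andP[ab bc] ca; rewrite /warea /wedge (@coneU _ a b c) ?ab// setIUr /area.
rewrite -/(wedge a b) -/(wedge b c).
have ab' : a <= b <= a + 2 * pi by lra.
have bc' : b <= c <= b + 2 * pi by lra.
have I0 : mu2 (wedge a b `&` wedge b c) = 0%E.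
  apply: (@subset_measure0 _ _ _ mu2 _ ([set x | det (dir a) x = 0] `|` [set x | det (dir b) x = 0])).
  - by apply: measurableI; exact: measurable_wedge.
  - by apply: measurableU; exact: measurable_line.
  - move=> x [[_ [s /= s1 sx]] [_ [t /= t1 tx]]].
    have [->|x0] := eqVneq x 0; first by left; rewrite /= /det !mulr0 subrr.
    have ol u : ray u x -> det (dir u) x = 0.
      by move=> /rayP[r r0 ->]; rewrite det_rayr det_dir subrr sin0 mulr0.
    have st : s <= t <= s + 2 * pi by lra.
    have [ts|ts] := ray_inter st sx tx x0.
      by right; rewrite /= (_ : b = s); [exact: ol|lra].
    by left; rewrite /= (_ : a = s); [exact: ol|lra].
  - apply: (@null_set_setU _ _ _ mu2); [exact: measurable_line|exact: measurable_line|..];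
    by apply: area_line; exact: dir_neq0.
have -> : mu2 (wedge a b `|` wedge b c) = (mu2 (wedge a b) + mu2 (wedge b c) -
   mu2 (wedge a b `&` wedge b c))%E.
  by apply: measureUfinl; [exact: measurable_wedge|exact: measurable_wedge|exact: wedge_mu_fin].
rewrite I0 sube0 fineD// ge0_fin_numE//; exact: wedge_mu_fin.
Qed.

Lemma wareaaa a : warea a a = 0.
Proof.
have := @warea_add a a a; rewrite lexx => /(_ erefl).
have := pi_gt0 R; lra.
Qed.

Lemma warea_le a b c d : c <= a <= b -> b <= d <= c + 2 * pi ->
  warea a b <= warea c d.
Proof.
move=> /andP[ca ab] /andP[bd dc].
have cd : c <= a <= d by rewrite ca (le_trans ab).
have ad : d <= a + 2 * pi by rewrite (le_trans dc)// lerD2r.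
rewrite (warea_add cd dc) (@warea_add a b d) ?ab//.
by rewrite ler_wpDl ?warea_ge0// lerDl warea_ge0.
Qed.

(** Convexity: the triangle with vertices 0, P, P' lies in K.  The bipolar theorem
reduces this to the values of covectors, which are convex combinations. *)
Lemma triangle_warea a b r s : a < b < a + pi -> 0 < r -> 0 < s ->
  K (r * (dir a).1, r * (dir a).2) -> K (s * (dir b).1, s * (dir b).2) ->
  r * s * sin (b - a) / 2 <= warea a b.
Proof.
move=> ab r0 s0; set P := (r * _, _); set P' := (s * _, _) => KP KP'.
have D : det P P' = r * s * sin (b - a) by rewrite det_ray det_rayr det_dir mulrA.
have sin0 : 0 < sin (b - a) by apply: sin_gt0_pi; lra.
have D0 : 0 < det P P' by rewrite D !mulr_gt0.
rewrite -D -[leLHS]/(fine (det P P' / 2)%:E) -area_triangle//.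
have ab' : a <= b <= a + 2 * pi by lra.
apply: le_area; [|exact: measurable_wedge| |exact: wedge_mu_fin].
  exact: measurable_triangle.
move=> x [x1 x2 x3]; split; last first.
  rewrite convex_coneE//=.
  by move: x1 x2; rewrite det_ray det_rayr !pmulr_rge0.
rewrite -(bipolar bK) => q Kq.
have : pairing x q * det P P' = det x P' * pairing q P + det P x * pairing q P'.
  by rewrite /det /pairing; ring.
rewrite -[pairing x q <= 1](ler_pM2r D0) mul1r => ->; apply: le_trans x3.
rewrite addrC; apply: lerD; apply: ler_piMr => //; exact: Kq.
Qed.

(** If one support line meets the two sides of a convex angle at U and V, the part of
K in this angle lies in the triangle 0 U V, because det(U, x) + det(x, V) is
<Q, x> det(U, V). *)
Lemma warea_triangle a b r s Q : a < b < a + pi -> 0 < r -> 0 < s ->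
  polar K Q -> pairing Q (r * (dir a).1, r * (dir a).2) = 1 ->
  pairing Q (s * (dir b).1, s * (dir b).2) = 1 ->
  warea a b <= r * s * sin (b - a) / 2.
Proof.
move=> ab r0 s0 KQ; set U := (r * _, _); set V := (s * _, _) => QU QV.
have D : det U V = r * s * sin (b - a) by rewrite det_ray det_rayr det_dir mulrA.
have sin0 : 0 < sin (b - a) by apply: sin_gt0_pi; lra.
have D0 : 0 < det U V by rewrite D !mulr_gt0.
rewrite -D -[leRHS]/(fine (det U V / 2)%:E) -area_triangle//.
have ab' : a <= b <= a + 2 * pi by lra.
apply: le_area; [exact: measurable_wedge| | |].
- exact: measurable_triangle.
- move=> x [Kx]; rewrite convex_coneE//= => -[x1 x2]; rewrite /triangle /=.
  rewrite det_ray det_rayr; split; rewrite ?pmulr_rge0//.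
  rewrite -(det_ray a) -(det_rayr b) -/U -/V.
  have -> : det U x + det x V = pairing Q x * det U V.
    rewrite -[det U x]mulr1 -[det x V]mulr1 -{1}QV -QU /det /pairing; ring.
  by rewrite ler_piMl ?(ltW D0)//; exact: KQ.
- by rewrite area_triangle// ltry.
Qed.

End Wedge.

(** * Parametrization of the boundary by the swept area *)

(* Keeps linear arithmetic from unfolding these integrals. *)
Opaque area warea.

Section Parametrization.
Context {R : realType} (K : set (R * R)).
Hypothesis bK : convex_body K.
Implicit Types (a b c t theta : R) (x P Q U V : R * R).

Local Notation warea := (warea K).

(** Apply [warea_triangle] to a line far enough from 0 and orthogonal to the bisector
of the angle. *)
Lemma warea_le_sin : exists2 C : R, 0 < C &
  forall a b, a < b <= a + pi / 2 -> warea a b <= C * sin (b - a).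
Proof.
have [M M0 KM] := body_bounded bK; have p0 := pi_gt0 R.
exists ((4 * M) * (4 * M) / 2); first by rewrite divr_gt0// !mulr_gt0.
move=> a b ab; rewrite mulrAC.
have cos0 : 0 <= cos (b - a) by apply: cos_ge0_pihalf; lra.
have N0 : 0 < (1 + cos (b - a)) * (4 * M) by rewrite mulr_gt0 ?mulr_gt0// ltr_wpDr.
have cE : cos (b - a) = cos b * cos a + sin b * sin a by rewrite cosB.
pose Q := ((cos a + cos b) / ((1 + cos (b - a)) * (4 * M)),
           (sin a + sin b) / ((1 + cos (b - a)) * (4 * M))).
have ca := cos2Dsin2 a; have cb := cos2Dsin2 b.
have QE x : pairing Q x = ((cos a + cos b) * x.1 + (sin a + sin b) * x.2) /
    ((1 + cos (b - a)) * (4 * M)) by rewrite /pairing /Q /=; ring.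
apply: (@warea_triangle _ _ bK _ _ _ _ Q); [lra|by rewrite mulr_gt0..| | |].
- move=> x /KM[x1 x2]; rewrite QE ler_pdivrMr// mul1r.
  have h (u v : R) : `|u| <= 1 -> `|v| <= M -> u * v <= M.
    move=> u1 v1; rewrite (le_trans (ler_norm _))// normrM.
    by rewrite -[leRHS]mul1r ler_pM.
  have := h _ _ (cos_max a) x1; have := h _ _ (cos_max b) x1.
  have := h _ _ (sin_max a) x2; have := h _ _ (sin_max b) x2.
  have := mulr_ge0 cos0 (ltW M0); lra.
- rewrite QE /=; apply: (mulIf (lt0r_neq0 N0)).
  rewrite divfK ?gt_eqF// mul1r cE.
  by have := congr1 (fun z => z * (4 * M)) ca; lra.
- rewrite QE /=; apply: (mulIf (lt0r_neq0 N0)).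
  rewrite divfK ?gt_eqF// mul1r cE.
  by have := congr1 (fun z => z * (4 * M)) cb; lra.
Qed.

Lemma warea_gt0 a b : a < b <= a + 2 * pi -> 0 < warea a b.
Proof.
move=> /andP[ab ba]; have p0 := pi_gt0 R.
pose c := Num.min b (a + pi / 2).
have acb : a < c <= b by rewrite /c lt_min ab ltrDl divr_gt0//= ge_min lexx.
have ca : c < a + pi by rewrite /c gt_min ltrD2l ltr_pdivrMr// ltr_pMr// ltr1n orbT.
have [r r0 br] := boundary_ray bK (dir_neq0 a).
have [s s0 bs] := boundary_ray bK (dir_neq0 c).
apply: (@lt_le_trans _ _ (r * s * sin (c - a) / 2)).
  rewrite divr_gt0// !mulr_gt0//; apply: sin_gt0_pi; lra.
apply: (@le_trans _ _ (warea a c)); last by apply: warea_le => //; lra.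
apply: triangle_warea => //; first lra.
- exact: boundary_subset br.
- exact: boundary_subset bs.
Qed.

Lemma area_body_gt0 : 0 < area K.
Proof. by rewrite -(warea_full K 0); apply: warea_gt0; have := pi_gt0 R; lra. Qed.

Lemma warea_lt a b : 0 <= a -> a < b <= 2 * pi -> warea 0 a < warea 0 b.
Proof.
move=> a0 /andP[ab b2].
rewrite (@warea_add _ _ bK 0 a b) ?add0r ?a0 ?(ltW ab)// ltrDl.
by apply: warea_gt0; rewrite ab/= (le_trans b2)// lerDr.
Qed.

(* Extends the swept area by constants outside the first turn, to a function
   that is continuous on the whole line. *)
Let clamp a := Num.max 0 (Num.min a (2 * pi)).

Let clampP a : 0 <= clamp a <= 2 * pi.
Proof. by rewrite /clamp le_max lexx /= ge_max ge_min lexx orbT andbT mulr_ge0// pi_ge0. Qed.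

Let clamp_contract a b : a <= b -> 0 <= clamp b - clamp a <= b - a.
Proof.
have p0 := pi_gt0 R; rewrite /clamp => ab.
case: (leP a (2 * pi)) => a2; case: (leP b (2 * pi)) => b2;
  case: (leP 0 a) => a0; case: (leP 0 b) => b0;
  rewrite ?max_r//; lra.
Qed.

Lemma warea_IVT y : 0 <= y < area K -> exists2 a, 0 <= a < 2 * pi & warea 0 a = y.
Proof.
move=> /andP[y0 yK]; have p0 := pi_gt0 R.
pose g a := warea 0 (clamp a).
have [C C0 WC] := warea_le_sin.
have cg : continuous g.
  move=> a; apply/cvgrPdist_lt => e e0.
  have := @continuous_sin R 0; rewrite /continuous_at sin0 => /cvgrPdist_lt.
  move=> /(_ (e / C) (divr_gt0 e0 C0)) /nbhs_ballP[d /= d0 dsin].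
  have small u v : u <= v -> v - u < Num.min d (pi / 2) -> `|g v - g u| < e.
    move=> uv; rewrite lt_min => /andP[vud vup].
    have := clamp_contract uv; rewrite subr_ge0 => /andP[cuv cvu].
    have := clampP u; have := clampP v => /andP[v0 v2] /andP[u0 u2].
    rewrite /g (@warea_add _ _ bK 0 (clamp u) (clamp v)) ?u0 ?add0r//.
    rewrite addrAC subrr add0r ger0_norm ?warea_ge0//.
    move: cuv; rewrite le_eqVlt => /predU1P[->|cuv]; first by rewrite wareaaa.
    apply: (le_lt_trans (WC _ _ _)); first by rewrite cuv/=; lra.
    rewrite mulrC -ltr_pdivlMr//.
    have : ball 0 d (clamp v - clamp u).
      rewrite /ball /= sub0r normrN gtr0_norm ?subr_gt0//.
      exact: le_lt_trans vud.
    by move=> /dsin; rewrite sub0r normrN; apply: le_lt_trans; exact: ler_norm.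
  have m0 : 0 < Num.min d (pi / 2) by rewrite lt_min d0 divr_gt0.
  near=> b.
  have : ball a (Num.min d (pi / 2)) b by near: b; exact: (nbhsx_ballx a _ m0).
  rewrite /ball /= ltr_norml => ab.
  by have [le|/ltW le] := leP a b; [rewrite distrC|]; apply: small => //; lra.
have clamp0 : clamp 0 = 0 by rewrite /clamp min_l ?maxxx// mulr_ge0// ltW.
have clamp2 : clamp (2 * pi) = 2 * pi.
  by rewrite /clamp minxx max_r// mulr_ge0// ltW.
have [] := @IVT R g 0 (2 * pi) y.
- by rewrite mulr_ge0// ltW.
- exact: continuous_subspaceT.
- rewrite /g clamp0 clamp2 wareaaa// -[2 * pi]add0r warea_full.
  by rewrite min_l ?max_r ?(ltW area_body_gt0)// y0 ltW.
move=> a _ ga; have /andP[a0 a2] := clampP a.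
exists (clamp a) => //; rewrite a0 lt_neqAle a2 andbT /=; apply/negP => /eqP a2E.
by move: yK; rewrite -ga /g a2E -[2 * pi]add0r warea_full ltxx.
Unshelve. all: by end_near. Qed.

Lemma bdpoint_spec_unique theta P Q :
  bdpoint_spec K theta P -> bdpoint_spec K theta Q -> P = Q.
Proof.
move=> [bP [a [/andP[a0 a2] aP]]]; rewrite sector_area => Wa.
move=> [bQ [b [/andP[b0 b2] bQ']]]; rewrite sector_area => Wb.
have ab : a = b.
  apply/eqP; rewrite eq_le !leNgt; apply/andP; split; apply/negP => lt.
    by have := @warea_lt b a b0; rewrite lt (ltW a2) Wa Wb ltxx => /(_ isT).
  by have := @warea_lt a b a0; rewrite lt (ltW b2) Wa Wb ltxx => /(_ isT).
subst b; move: aP bQ' => /rayP[r r0 PE] /rayP[s s0 QE].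
have pos u (p : R * R) : 0 <= u -> p = (u * (dir a).1, u * (dir a).2) ->
    boundary K p -> 0 < u.
  move=> u0 pE /(boundary_neq0 bK); rewrite pE /= !exprMn -mulrDr => h.
  rewrite lt_neqAle u0 andbT; apply/eqP => u0E.
  by move: h; rewrite -u0E expr0n /= mul0r ltxx.
have {}r0 := pos _ _ r0 PE bP; have {}s0 := pos _ _ s0 QE bQ.
have sr : s / r = 1.
  apply: (@boundary_ray_inj _ K P) => //; first exact: divr_gt0.
  rewrite PE /= !mulrA !divfK ?gt_eqF//; by rewrite -QE.
by rewrite PE QE -[s](divfK (lt0r_neq0 r0)) sr mul1r.
Qed.

Lemma bdpointP theta : bdpoint_spec K (modR (2 * area K) theta) (bdpoint K theta).
Proof.
have S0 := area_body_gt0.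
have /andP[t0 t2] := modR_itv theta (mulr_gt0 (ltr0Sn R 1) S0).
have [|a a0 Wa] := @warea_IVT (modR (2 * area K) theta / 2).
  by lra.
have [r r0 br] := boundary_ray bK (dir_neq0 a).
apply: (@getPex _ (bdpoint_spec K (modR (2 * area K) theta))).
exists (r * (dir a).1, r * (dir a).2); split => //; exists a; split => //.
by apply/rayP; exists r => //; exact: ltW.
Qed.

Lemma bdpoint_boundary theta : boundary K (bdpoint K theta).
Proof. by case: (bdpointP theta). Qed.

Lemma modR_small (p t : R) : 0 <= t < p -> modR p t = t.
Proof.
move=> /andP[t0 tp]; rewrite /modR (_ : Num.floor _ = 0) ?mul0r ?subr0//.
apply: floor_def; rewrite add0r ler_pdivlMr ?mul0r ?ltr_pdivrMr ?mul1r ?t0//;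
exact: le_lt_trans tp.
Qed.

Lemma bdpoint_surj P : boundary K P -> exists theta, bdpoint K theta = P.
Proof.
move=> bP; have [a [/andP[a0 a2] aP]] := polar_coord 0 P.
rewrite add0r in a2.
exists (2 * warea 0 a).
apply: (@bdpoint_spec_unique (modR (2 * area K) (2 * warea 0 a))); first exact: bdpointP.
split => //; exists a; split => //; first by rewrite a0.
rewrite modR_small; last first.
  rewrite mulr_ge0 ?warea_ge0//= ltr_pM2l// -(warea_full K 0) add0r.
  by apply: warea_lt => //; rewrite a2/=.
by rewrite sector_area mulrC mulKf.
Qed.

(** Both angles start in the first turn; if the two parameters are separated by a
multiple of the period, a full turn is added to the second angle. *)
Lemma bdpoint_wedge theta1 theta2 :
  theta1 < theta2 < theta1 + 2 * area K ->
  exists a b, [/\ a < b < a + 2 * pi, ray a (bdpoint K theta1),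
    ray b (bdpoint K theta2) & theta2 - theta1 = 2 * warea a b].
Proof.
move=> /andP[t12 t21]; have S0 := area_body_gt0; have p0 := pi_gt0 R.
have [_ [a [/andP[a0 a2] aP Wa]]] := bdpointP theta1.
have [_ [b [/andP[b0 b2] bP Wb]]] := bdpointP theta2.
rewrite sector_area in Wa; rewrite sector_area in Wb.
have p2 : 0 < 2 * area K by exact: mulr_gt0.
have := modR_itv theta1 p2; have := modR_itv theta2 p2.
move: Wa Wb; rewrite /modR; set k1 := Num.floor _; set k2 := Num.floor (theta2 / _).
move=> Wa Wb /andP[m20 m2] /andP[m10 m1].
have dE : (k2 - k1)%:~R * (2 * area K) = theta2 - theta1 - 2 * (warea 0 b - warea 0 a).
  by rewrite Wa Wb intrB; field.
have d1 : (-1 < k2 - k1)%R.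
  by rewrite -(ltr_int R) -(ltr_pM2r p2) dE Wa Wb rmorphN /=; lra.
have d2 : (k2 - k1 < 2)%R.
  by rewrite -(ltr_int R) -(ltr_pM2r p2) dE Wa Wb /=; lra.
have [d0|d0] : k2 - k1 = 0 \/ k2 - k1 = 1.
  by move: d1 d2; move: (k2 - k1); clear; lia.
  rewrite d0 mul0r in dE.
  have ab : a < b.
    rewrite ltNge; apply/negP; rewrite le_eqVlt => /predU1P[ba|ba].
      by move: dE t12; rewrite ba; clear; lra.
    have := @warea_lt b a b0; rewrite ba (ltW a2) => /(_ isT).
    by move: dE t12; move: (warea _ _) (warea _ _) => u v; clear; lra.
  exists a, b; split => //; first by rewrite ab (lt_le_trans b2)// lerDr.
  have := @warea_add _ _ bK 0 a b; rewrite a0 (ltW ab) add0r (ltW b2) => /(_ isT isT).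
  by move: dE; move: (warea _ _) (warea _ _) (warea _ _) => u v w; clear; lra.
rewrite d0 mul1r in dE.
have ba : b < a.
  rewrite ltNge; apply/negP; rewrite le_eqVlt => /predU1P[ab|ab].
    by move: dE t21; rewrite ab; clear; lra.
  have := @warea_lt a b a0; rewrite ab (ltW b2) => /(_ isT).
  by move: dE t21; move: (warea _ _) (warea _ _) => u v; clear; lra.
exists a, (b + 2 * pi); split => //; first by rewrite (lt_le_trans a2) ?lerDr//= ltrD2r.
  by rewrite (@eq_ray _ _ b)// dirD2pi.
have c1 : a <= 2 * pi <= b + 2 * pi by rewrite (ltW a2) lerDr.
have c2 : b + 2 * pi <= a + 2 * pi by rewrite lerD2r ltW.
have c3 : 0 <= a <= 2 * pi by rewrite a0 ltW.
have c4 : 2 * pi <= 0 + 2 * pi :> R by rewrite add0r.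
have e1 := warea_add bK c1 c2; have e2 := warea_add bK c3 c4.
have e3 := wareaD2pi K 0 b; have e4 := warea_full K 0; rewrite !add0r in e3 e4.
move: dE; rewrite e1 e3 -e4 e2.
move: (warea 0 a) (warea 0 b) (warea a (2 * pi)) => u v w.
by clear; lra.
Qed.

End Parametrization.

(** * Comparison of the swept area with triangles *)

Section Local.
Context {R : realType} (K : set (R * R)).
Hypothesis bK : convex_body K.
Implicit Types (theta : R) (P Q : R * R).

Local Notation P := (bdpoint K).

Lemma boundary_on_ray t (x : R * R) : boundary K x -> ray t x ->
  exists2 r, 0 < r & x = (r * (dir t).1, r * (dir t).2).
Proof.
move=> bx /rayP[r r0 xE]; exists r => //; rewrite lt_neqAle r0 andbT.
apply/eqP => r0E; have := boundary_neq0 bK bx.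
by rewrite xE -r0E /= !mul0r expr0n /= addr0 ltxx.
Qed.

Lemma pairing_dir Q r t :
  pairing Q (r * (dir t).1, r * (dir t).2) = r * pairing Q (dir t).
Proof. by rewrite /pairing /=; ring. Qed.

(** The bound d forces the two angles to differ by less than a right angle, since a
quarter turn sweeps at least the right triangle inscribed in a disc inside K.
Then the swept area is compared with the triangle 0 P1 P2 from below, and with
the triangles cut out by the support lines at P1 and P2 from above. *)
Lemma bdpoint_local : exists2 d : R, 0 < d &
  forall theta1 theta2, theta1 < theta2 < theta1 + d ->
  [/\ 0 <= pairing (P theta1) (P theta2),
      0 < det (P theta1) (P theta2) <= theta2 - theta1,
      forall Q, polar K Q -> pairing Q (P theta1) = 1 ->
        (theta2 - theta1) * pairing Q (P theta2) <= det (P theta1) (P theta2) &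
      forall Q, polar K Q -> pairing Q (P theta2) = 1 ->
        (theta2 - theta1) * pairing Q (P theta1) <= det (P theta1) (P theta2)].
Proof.
have [r r0 rK] := (interior_box K 0).1 (body_int0 bK).
have p0 := pi_gt0 R; have S0 := area_body_gt0 bK.
have Kdir t : K (r * (dir t).1, r * (dir t).2).
  by apply: rK; rewrite /= subr0 normrM (gtr0_norm r0) ler_piMr ?(ltW r0)// ?cos_max ?sin_max.
exists (Num.min (r * r) (2 * area K)); first by rewrite lt_min !mulr_gt0.
move=> t1 t2 /andP[t12]; rewrite -ltrBlDl lt_min => /andP[t21 t2S].
have [|a [b [/andP[ab b2] aP bP tW]]] := bdpoint_wedge bK (_ : t1 < t2 < t1 + 2 * area K).
  by rewrite t12 -ltrBlDl.
have bap : b < a + pi / 2.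
  rewrite ltNge; apply/negP => le; move: t21; rewrite ltNge => /negP; apply.
  have := @triangle_warea _ _ bK a (a + pi / 2) r r.
  rewrite addrAC subrr add0r sin_pihalf mulr1 => /(_ _ r0 r0 (Kdir _) (Kdir _)) h.
  have /h {}h : a < a + pi / 2 < a + pi by apply/andP; split; lra.
  suff : r * r / 2 <= warea K a b.
    by rewrite tW; move: (warea _ _ _) => w; lra.
  apply: (le_trans h).
  by apply: warea_le => //; rewrite ?le ?lexx/= ?lerDl ?(ltW b2)// divr_ge0 ?ltW.
have [r1 r10 P1E] := boundary_on_ray (bdpoint_boundary bK t1) aP.
have [r2 r20 P2E] := boundary_on_ray (bdpoint_boundary bK t2) bP.
have D : det (P t1) (P t2) = r1 * r2 * sin (b - a).
  by rewrite P1E P2E det_ray det_rayr det_dir mulrA.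
have bd : 0 < b - a < pi by apply/andP; split; lra.
have s0 : 0 < sin (b - a) by exact: sin_gt0_pi.
have abp : a < b < a + pi by apply/andP; split; lra.
have D0 : 0 < det (P t1) (P t2) by rewrite D !mulr_gt0.
have K1 := boundary_subset bK (bdpoint_boundary bK t1).
have K2 := boundary_subset bK (bdpoint_boundary bK t2).
split.
- rewrite P1E P2E [pairing _ _](_ : _ = r1 * r2 * cos (b - a)).
    by rewrite !mulr_ge0 ?(ltW r10) ?(ltW r20)// cos_ge0_pihalf//; apply/andP; split; lra.
  by rewrite cosB /pairing /=; ring.
- rewrite D0 D /= tW -ler_pdivrMl// [2^-1 * _]mulrC.
  by apply: triangle_warea; rewrite // -?P1E -?P2E.
- move=> Q KQ Q1; have [c0|c0] := leP (pairing Q (P t2)) 0.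
    by rewrite (le_trans _ (ltW D0))// mulr_ge0_le0// subr_ge0 ltW.
  have QV : pairing Q (r2 / pairing Q (P t2) * (dir b).1,
      r2 / pairing Q (P t2) * (dir b).2) = 1.
    by rewrite pairing_dir mulrAC -pairing_dir -P2E divff// gt_eqF.
  have := warea_triangle bK abp r10 (divr_gt0 r20 c0) KQ _ QV.
  rewrite -P1E => /(_ Q1).
  have e : r1 * r2 * sin (b - a) / pairing Q (P t2) =
      2 * (r1 * (r2 / pairing Q (P t2)) * sin (b - a) / 2) by field; rewrite gt_eqF.
  by rewrite tW -ler_pdivlMr// D e ler_pM2l.
- move=> Q KQ Q2; have [c0|c0] := leP (pairing Q (P t1)) 0.
    by rewrite (le_trans _ (ltW D0))// mulr_ge0_le0// subr_ge0 ltW.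
  have QV : pairing Q (r1 / pairing Q (P t1) * (dir a).1,
      r1 / pairing Q (P t1) * (dir a).2) = 1.
    by rewrite pairing_dir mulrAC -pairing_dir -P1E divff// gt_eqF.
  have := warea_triangle bK abp (divr_gt0 r10 c0) r20 KQ QV.
  rewrite -P2E => /(_ Q2).
  have e : r1 * r2 * sin (b - a) / pairing Q (P t1) =
      2 * (r1 / pairing Q (P t1) * r2 * sin (b - a) / 2) by field; rewrite gt_eqF.
  by rewrite tW -ler_pdivlMr// D e ler_pM2l.
Qed.

End Local.

(** * Chords and one-sided derivatives *)

Section Chord.
Context {R : realType}.
Implicit Types P Q : R * R.

Lemma pairing_det P0 P1 Q : pairing P0 P0 * pairing Q P1 =
  pairing Q P0 * pairing P0 P1 + det P0 Q * det P0 P1.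
Proof. by rewrite /pairing /det; ring. Qed.

(** The line through P0 and P1 is <Q, x> = 1 for a single covector Q, and this is
det(P0, Q). *)
Definition chord_slope P0 P1 : R := (pairing P0 P0 - pairing P0 P1) / det P0 P1.

Lemma chord_slopeK P0 P1 : det P0 P1 != 0 ->
  chord_slope P0 P1 * det P0 P1 = pairing P0 P0 - pairing P0 P1.
Proof. by move=> D0; rewrite /chord_slope divfK. Qed.

(** Q supports K at P0.  Multiplying by det(P0, P1), instead of dividing, treats both
sides of P0 at once. *)
Lemma le_chord_slope P0 P1 Q : det P0 P1 != 0 -> 0 <= pairing P0 P0 ->
  pairing Q P0 = 1 -> pairing Q P1 <= 1 ->
  det P0 Q * det P0 P1 <= chord_slope P0 P1 * det P0 P1.
Proof.
move=> D0 n0 Q0 Q1; rewrite chord_slopeK//.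
by have := pairing_det P0 P1 Q; have := ler_wpM2l n0 Q1; rewrite Q0; lra.
Qed.

(** Here Q supports K at the other end of the chord, which reverses the inequality. *)
Lemma chord_slope_le P0 P1 Q : det P0 P1 != 0 -> 0 <= pairing P0 P1 ->
  pairing Q P0 <= 1 -> pairing Q P1 = 1 ->
  chord_slope P0 P1 * det P0 P1 <= det P0 Q * det P0 P1.
Proof.
move=> D0 n0 Q0 Q1; rewrite chord_slopeK//.
by have := pairing_det P0 P1 Q; have := ler_wpM2r n0 Q0; rewrite Q1; lra.
Qed.

(** This says that P1 - P0 = det(P0, P1) J Q for the covector Q of the chord. *)
Lemma chordE P0 P1 : det P0 P1 != 0 -> pairing P0 P0 != 0 ->
  P1.1 - P0.1 = det P0 P1 * (- (P0.2 + chord_slope P0 P1 * P0.1) / pairing P0 P0) /\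
  P1.2 - P0.2 = det P0 P1 * ((P0.1 - chord_slope P0 P1 * P0.2) / pairing P0 P0).
Proof.
move=> D0 n0; have := chord_slopeK D0; set t := chord_slope P0 P1 => tE.
split; apply: (mulIf n0); rewrite mulrA divfK//.
  by have := congr1 (fun z => z * P0.1) tE; rewrite /pairing /det; lra.
by have := congr1 (fun z => z * P0.2) tE; rewrite /pairing /det; lra.
Qed.

(** Expansion of Q in the orthogonal basis (P0, J P0). *)
Lemma covectorE P0 Q : pairing P0 P0 != 0 -> pairing Q P0 = 1 ->
  Q.1 = (P0.1 - det P0 Q * P0.2) / pairing P0 P0 /\
  Q.2 = (P0.2 + det P0 Q * P0.1) / pairing P0 P0.
Proof.
move=> n0 Q0; split; apply: (mulIf n0); rewrite divfK//.
  by have := congr1 (fun z => z * P0.1) Q0; rewrite /pairing /det; lra.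
by have := congr1 (fun z => z * P0.2) Q0; rewrite /pairing /det; lra.
Qed.

End Chord.

Section Derivatives.
Context {R : realType} (K : set (R * R)).
Hypothesis bK : convex_body K.
Implicit Types (theta h : R) (Q : R * R).

Local Notation P := (bdpoint K).

Lemma boundary_pairing_gt0 (x : R * R) : boundary K x -> 0 < pairing x x.
Proof. by move=> /(boundary_neq0 bK); rewrite /pairing -!expr2. Qed.

Lemma bdpoint_in theta : K (P theta).
Proof. exact: boundary_subset (bdpoint_boundary bK theta). Qed.

(** The part of [bdpoint_local] that is used for derivatives, with an increment of
either sign. *)
Lemma bdpoint_local_sym : exists2 d : R, 0 < d &
  forall theta h, h != 0 -> `|h| < d ->
  [/\ 0 <= pairing (P theta) (P (theta + h)),
      0 < det (P theta) (P (theta + h)) / h <= 1 &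
      forall Q, polar K Q -> pairing Q (P theta) = 1 ->
        pairing Q (P (theta + h)) <= det (P theta) (P (theta + h)) / h].
Proof.
have [d d0 dP] := bdpoint_local bK; exists d => // theta h h0 hd.
have [h_lt0|h_gt0|hE] := ltgtP h 0; last by rewrite hE eqxx in h0.
  have [|p /andP[D1 D2] _ D3] := dP (theta + h) theta.
    by rewrite ltr0_norm// in hd; apply/andP; split; lra.
  have DE : det (P theta) (P (theta + h)) / h = det (P (theta + h)) (P theta) / - h.
    by rewrite detC invrN mulrN mulNr.
  have hN : theta - (theta + h) = - h by ring.
  rewrite DE; rewrite hN in D2 D3.
  split; first by rewrite pairingC.
    by rewrite divr_gt0 ?oppr_gt0//= ler_pdivrMr ?oppr_gt0// mul1r.
  by move=> Q KQ Q1; rewrite ler_pdivlMr ?oppr_gt0// mulrC D3.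
have [|p /andP[D1 D2] D3 _] := dP theta (theta + h).
  by rewrite gtr0_norm// in hd; apply/andP; split; lra.
have hN : theta + h - theta = h by ring.
rewrite hN in D2 D3.
split => //; first by rewrite divr_gt0//= ler_pdivrMr// mul1r.
by move=> Q KQ Q1; rewrite ler_pdivlMr// mulrC D3.
Qed.

(** For close parameters, the covector of the chord is bounded, since it lies between
two points of the polar; for distant ones, the points themselves are bounded. *)
Lemma bdpoint_lipschitz : exists2 C : R, 0 < C & forall theta1 theta2,
  `|(P theta1).1 - (P theta2).1| <= C * `|theta1 - theta2| /\
  `|(P theta1).2 - (P theta2).2| <= C * `|theta1 - theta2|.
Proof.
have [d d0 dP] := bdpoint_local_sym.
have [M M0 KM] := body_bounded bK.
have [N N0 KN] := body_bounded (polar_body bK).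
pose C1 := (M + (2 * M * N) * M) * (2 * N ^+ 2).
have C10 : 0 < C1 by rewrite !mulr_gt0// addr_gt0// !mulr_gt0.
pose C := C1 + 2 * M / d.
exists C; first by rewrite addr_gt0// divr_gt0// mulr_gt0.
have near t h : h != 0 -> `|h| < d ->
    `|(P (t + h)).1 - (P t).1| <= C1 * `|h| /\
    `|(P (t + h)).2 - (P t).2| <= C1 * `|h|.
  move=> h0 hd; have [p /andP[D1 D2] _] := dP t h h0 hd.
  set P0 := P t in p D1 D2 *; set P1 := P (t + h) in p D1 D2 *.
  have [x1 x2] : `|P0.1| <= M /\ `|P0.2| <= M := KM _ (bdpoint_in t).
  have n0 : 0 < pairing P0 P0 := boundary_pairing_gt0 (bdpoint_boundary bK t).
  have D0 : det P0 P1 != 0.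
    by apply/eqP => D0; rewrite D0 mul0r ltxx in D1.
  have [Q0 KQ0 Q00] := boundary_support bK (bdpoint_boundary bK t).
  have [Q1 KQ1 Q11] := boundary_support bK (bdpoint_boundary bK (t + h)).
  have le0 := le_chord_slope D0 (ltW n0) Q00 (KQ0 _ (bdpoint_in (t + h))).
  have le1 := chord_slope_le D0 p (KQ1 _ (bdpoint_in t)) Q11.
  have gb Q : polar K Q -> `|det P0 Q| <= 2 * M * N.
    move=> /KN[q1 q2]; rewrite /det (le_trans (ler_normB _ _))// !normrM.
    by have := ler_pM (normr_ge0 _) (normr_ge0 _) x1 q2;
      have := ler_pM (normr_ge0 _) (normr_ge0 _) x2 q1; lra.
  have tb : `|chord_slope P0 P1| <= 2 * M * N.
    have := gb _ KQ0; have := gb _ KQ1; rewrite !ler_norml.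
    have [Dn|Dp|DE] := ltgtP (det P0 P1) 0; last by rewrite DE eqxx in D0.
      by move: le0 le1; rewrite !ler_nM2r// => ? ? /andP[? ?] /andP[? ?]; apply/andP; split; lra.
    by move: le0 le1; rewrite !ler_pM2r// => ? ? /andP[? ?] /andP[? ?]; apply/andP; split; lra.
  have ninv : (pairing P0 P0)^-1 <= 2 * N ^+ 2.
    rewrite -[_^-1]mul1r ler_pdivrMr//.
    have [q1 q2] := KN _ KQ0.
    have s1 : 1 <= N * `|P0.1| + N * `|P0.2|.
      rewrite -Q00 (le_trans (ler_norm _))// (le_trans (ler_normD _ _))// !normrM.
      by rewrite lerD// ler_wpM2r.
    have s2 : 1 <= (N * `|P0.1| + N * `|P0.2|) ^+ 2 by rewrite exprn_ege1.
    have := mulr_ge0 (sqr_ge0 N) (sqr_ge0 (`|P0.1| - `|P0.2|)).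
    have := real_normK (num_real P0.1); have := real_normK (num_real P0.2).
    rewrite /pairing -!expr2 => <- <-; move: s2.
    by move: `|P0.1| `|P0.2| => u v; lra.
  have Dh : `|det P0 P1| <= `|h|.
    have : `|det P0 P1 / h| <= 1 by rewrite gtr0_norm.
    by rewrite normrM normfV ler_pdivrMr ?normr_gt0// mul1r.
  have [-> ->] := chordE D0 (lt0r_neq0 n0).
  have fin (u v : R) : `|u| <= M -> `|v| <= M ->
      `|det P0 P1 * ((u + chord_slope P0 P1 * v) / pairing P0 P0)| <= C1 * `|h|.
    move=> uM vM; rewrite normrM mulrC ler_pM//.
    rewrite normrM (ger0_norm (_ : 0 <= _^-1)) ?invr_ge0 ?(ltW n0)//.
    rewrite ler_pM ?invr_ge0 ?(ltW n0)//.
    by rewrite (le_trans (ler_normD _ _))// lerD// normrM ler_pM.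
  split.
    rewrite mulNr mulrN normrN; exact: fin.
  by rewrite -mulrN; apply: fin; rewrite ?normrN.
have C1C (x : R) : C1 * `|x| <= C * `|x|.
  by rewrite ler_wpM2r// lerDl divr_ge0 ?mulr_ge0 ?(ltW M0) ?(ltW d0).
move=> t1 t2; have [->|t12] := eqVneq t1 t2.
  by rewrite !subrr normr0 mulr0.
have [tn|tf] := ltP `|t1 - t2| d.
  have [] := near t2 (t1 - t2) _ tn; first by rewrite subr_eq0.
  rewrite (_ : t2 + (t1 - t2) = t1); last by ring.
  move=> e1 e2.
  by split; [exact: le_trans e1 (C1C _)|exact: le_trans e2 (C1C _)].
have far (u v : R) : `|u| <= M -> `|v| <= M -> `|u - v| <= C * `|t1 - t2|.
  move=> uM vM; apply: (@le_trans _ _ (2 * M)).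
    by rewrite (le_trans (ler_normB _ _))//; lra.
  apply: (@le_trans _ _ (2 * M / d * `|t1 - t2|)).
    by rewrite mulrAC ler_pdivlMr// ler_pM2l// mulr_gt0.
  by rewrite ler_wpM2r// lerDr ltW.
have [a1 a2] := KM _ (bdpoint_in t1); have [b1 b2] := KM _ (bdpoint_in t2).
by split; exact: far.
Qed.

Definition face theta : set (R * R) :=
  [set Q | polar K Q /\ pairing Q (P theta) = 1].

Lemma face_neq0 theta : face theta !=set0.
Proof.
by have [Q KQ Q1] := boundary_support bK (bdpoint_boundary bK theta); exists Q.
Qed.

Lemma det_continuous (x : R * R) : continuous (det x).
Proof.
move=> y; rewrite (_ : det x = (fun y => - x.2 * y.1 + x.1 * y.2)).
  exact: linear_form_continuous.
by apply/funext => z; rewrite /det; ring.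
Qed.

Lemma compact_polar_closed (F : set (R * R)) : closed F -> compact (polar K `&` F).
Proof.
move=> cF; have bK' := polar_body bK.
apply: subclosed_compact (body_compact bK') _; last by move=> ? [].
by apply: closedI => //; exact: body_closed.
Qed.

Lemma closed_pairing_ge (x : R * R) (c : R) : closed [set Q | c <= pairing Q x].
Proof.
rewrite [X in closed X](_ : _ = [set Q | - x.1 * Q.1 + - x.2 * Q.2 <= - c]).
  exact: closed_halfplane.
by apply/seteqP; split => Q /=; rewrite /pairing; lra.
Qed.

Lemma closed_det_ge (x : R * R) (c d : R) : closed [set Q | c <= d * det x Q].
Proof.
rewrite [X in closed X](_ : _ = [set Q | d * x.2 * Q.1 + - (d * x.1) * Q.2 <= - c]).
  exact: closed_halfplane.
by apply/seteqP; split => Q /=; rewrite /det; lra.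
Qed.

Lemma face_extreme theta (s : R) : exists2 Q, face theta Q &
  forall Q', face theta Q' -> s * det (P theta) Q' <= s * det (P theta) Q.
Proof.
have faceE : face theta = polar K `&` [set Q | 1 <= pairing Q (P theta)].
  apply/seteqP; split => Q [KQ Q1]; split => //; first by rewrite /= Q1.
  by apply/eqP; rewrite eq_le Q1 KQ//; exact: bdpoint_in.
have [||Q /set_mem FQ Qmax] :=
    @compact_EVT_max _ _ (fun Q => s * det (P theta) Q) (face theta) (face_neq0 theta).
- by rewrite faceE; apply: compact_polar_closed; exact: closed_pairing_ge.
- apply: continuous_subspaceT => Q; apply: cvgM; first exact: cvg_cst.
  exact: det_continuous.
by exists Q => // Q' /mem_set; exact: Qmax.
Qed.

(** Upper semicontinuity of the face: if some covectors of the polar stayed away from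
the face in the direction det(P0, _), then by compactness one of them would be
maximal at P0 among them, with a value below 1. *)
Lemma face_usc theta (s m e : R) :
  (forall Q, face theta Q -> s * det (P theta) Q <= m) -> 0 < e ->
  exists2 eta, 0 < eta & forall Q, polar K Q -> 1 - eta <= pairing Q (P theta) ->
    s * det (P theta) Q < m + e.
Proof.
move=> mF e0.
have [[Q0 [KQ0 Q0m]]|none] := pselect (exists Q, polar K Q /\ m + e <= s * det (P theta) Q);
    last first.
  exists 1 => // Q KQ _; rewrite ltNge; apply/negP => h.
  by apply: none; exists Q.
pose A := polar K `&` [set Q | m + e <= s * det (P theta) Q].
have [|||Q /set_mem[KQ Qm] Qmax] := @compact_EVT_max _ _ (fun q => pairing q (P theta)) A.
- by exists Q0.
- by apply: compact_polar_closed; exact: closed_det_ge.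
- apply: continuous_subspaceT => Q.
  rewrite (_ : (fun q => pairing q _) = pairing (P theta)); first exact: pairing_continuous.
  by apply/funext => z; exact: pairingC.
have Q1 : pairing Q (P theta) < 1.
  rewrite lt_neqAle KQ ?andbT; last exact: bdpoint_in.
  apply/eqP => Q1; have /mF : face theta Q by [].
  by move: Qm => /=; lra.
exists ((1 - pairing Q (P theta)) / 2); first by rewrite divr_gt0// subr_gt0.
move=> Q' KQ' Q'1; rewrite ltNge; apply/negP => h.
have /mem_set/Qmax : A Q' by [].
lra.
Qed.

Lemma pairing_bdpoint_lipschitz : exists2 C : R, 0 < C &
  forall Q theta1 theta2, polar K Q ->
    `|pairing Q (P theta1) - pairing Q (P theta2)| <= C * `|theta1 - theta2|.
Proof.
have [N N0 KN] := body_bounded (polar_body bK).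
have [C C0 CP] := bdpoint_lipschitz.
exists (2 * N * C); first by rewrite !mulr_gt0.
move=> Q t1 t2 /KN[q1 q2]; have [c1 c2] := CP t1 t2.
rewrite /pairing (_ : _ - _ = Q.1 * ((P t1).1 - (P t2).1) + Q.2 * ((P t1).2 - (P t2).2));
  last by ring.
rewrite (le_trans (ler_normD _ _))// !normrM.
have := ler_pM (normr_ge0 _) (normr_ge0 _) q1 c1.
have := ler_pM (normr_ge0 _) (normr_ge0 _) q2 c2.
lra.
Qed.

(** The sign s selects a side of 0, so that both one-sided limits have one proof. *)
Definition side (s : R) : set_system R := within (fun h => 0 < s * h) (nbhs (0 : R)).

Global Instance side_filter s : Filter (side s).
Proof. exact: within_filter. Qed.

Lemma near_side (s e : R) : 0 < e -> \forall h \near side s, 0 < s * h /\ `|h| < e.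
Proof.
move=> e0; apply: filterS (_ : \forall h \near nbhs (0 : R), ball 0 e h).
  by move=> h; rewrite /ball /= sub0r normrN.
exact: nbhsx_ballx.
Qed.

(** The ratio lies between <Q, P1> and 1 for a covector Q that supports K at P0. *)
Lemma area_ratio_cvg theta (s : R) :
  det (P theta) (P (theta + h)) / h @[h --> side s] --> (1 : R).
Proof.
have [d d0 dP] := bdpoint_local_sym; have [C C0 CP] := pairing_bdpoint_lipschitz.
have [Q [KQ Q1]] := face_neq0 theta.
apply/cvgrPdist_lt => e e0.
have m0 : 0 < Num.min d (e / C) by rewrite lt_min d0 divr_gt0.
apply: filterS (near_side s m0) => h [sh]; rewrite lt_min => /andP[hd he].
have h0 : h != 0 by apply/eqP => h0; rewrite h0 mulr0 ltxx in sh.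
have [_ /andP[_ D1] /(_ Q KQ Q1) D2] := dP theta h h0 hd.
rewrite ger0_norm ?subr_ge0//.
have := CP Q theta (theta + h) KQ; rewrite Q1 (_ : theta - _ = - h) ?normrN; last by ring.
move=> /(le_trans (ler_norm _)).
by move: he; rewrite ltr_pdivlMr// => he; lra.
Qed.

(** The chord lies between the end Q of the face and a covector supporting K at P1,
which is close to the face by [face_usc]. *)
Lemma chord_slope_cvg theta (s : R) Q : s * s = 1 -> face theta Q ->
  (forall Q', face theta Q' -> s * det (P theta) Q' <= s * det (P theta) Q) ->
  chord_slope (P theta) (P (theta + h)) @[h --> side s] --> det (P theta) Q.
Proof.
move=> ss [KQ Q1] Qmax.
have [d d0 dP] := bdpoint_local_sym; have [C C0 CP] := pairing_bdpoint_lipschitz.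
have n0 : 0 < pairing (P theta) (P theta).
  exact: boundary_pairing_gt0 (bdpoint_boundary bK theta).
apply/cvgrPdist_lt => e e0; have [eta eta0 etaP] := face_usc Qmax e0.
have m0 : 0 < Num.min d (eta / C) by rewrite lt_min d0 divr_gt0.
apply: filterS (near_side s m0) => h [sh]; rewrite lt_min => /andP[hd he].
have h0 : h != 0 by apply/eqP => h0; rewrite h0 mulr0 ltxx in sh.
have [p /andP[D1 _] _] := dP theta h h0 hd.
have [Q' KQ' Q'1] := boundary_support bK (bdpoint_boundary bK (theta + h)).
set D := det (P theta) (P (theta + h)) in D1.
have D0 : D != 0 by apply/eqP => D0; rewrite D0 mul0r ltxx in D1.
have sD : 0 < s * D by rewrite -[D](divfK h0) mulrCA mulr_gt0.
have := le_chord_slope D0 (ltW n0) Q1 (KQ _ (bdpoint_in _)).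
have := chord_slope_le D0 p (KQ' _ (bdpoint_in _)) Q'1.
have sM u v : u * D <= v * D -> s * u <= s * v.
  move=> uv; rewrite -(ler_pM2r sD).
  by rewrite !mulrA ![s * _ * s]mulrAC ss !mul1r.
rewrite -/D => /sM le1 /sM le0.
have : s * det (P theta) Q' < s * det (P theta) Q + e.
  apply: etaP => //; have := CP Q' theta (theta + h) KQ'.
  rewrite Q'1 (_ : theta - _ = - h) ?normrN; last by ring.
  rewrite ler_norml => /andP[+ _].
  by move: he; rewrite ltr_pdivlMr// => he; lra.
have -> (u : R) : `|u| = `|s * u|.
  rewrite normrM (_ : `|s| = 1) ?mul1r//.
  by apply/eqP; rewrite -sqr_norm_eq1 expr2 ss.
by move=> lt; rewrite mulrBr ler0_norm ?subr_le0//; lra.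
Qed.

Lemma bdpoint_side_derivative theta (s : R) Q : s * s = 1 -> face theta Q ->
  (forall Q', face theta Q' -> s * det (P theta) Q' <= s * det (P theta) Q) ->
  (h^-1 * (gcos K (theta + h) - gcos K theta) @[h --> side s] --> - Q.2) /\
  (h^-1 * (gsin K (theta + h) - gsin K theta) @[h --> side s] --> Q.1).
Proof.
move=> ss FQ Qmax; have [KQ Q1] := FQ.
have n0 : 0 < pairing (P theta) (P theta).
  exact: boundary_pairing_gt0 (bdpoint_boundary bK theta).
have [E1 E2] := covectorE (lt0r_neq0 n0) Q1.
have cvt := chord_slope_cvg ss FQ Qmax; have cvr := area_ratio_cvg theta s.
have [d d0 dP] := bdpoint_local_sym.
have ev (f g : R -> R) (l : R) : (forall h, h != 0 -> `|h| < d ->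
    det (P theta) (P (theta + h)) != 0 -> f h = g h) ->
    f h @[h --> side s] --> l -> g h @[h --> side s] --> l.
  move=> fg; apply: cvg_trans; apply: near_eq_cvg.
  apply: filterS (near_side s d0) => h [sh hd].
  have h0 : h != 0 by apply/eqP => h0; rewrite h0 mulr0 ltxx in sh.
  have [_ /andP[D1 _] _] := dP theta h h0 hd.
  by rewrite fg//; apply/eqP => D0; rewrite D0 mul0r ltxx in D1.
split.
  rewrite (_ : - Q.2 = 1 * (- ((P theta).2 + det (P theta) Q * (P theta).1) *
    (pairing (P theta) (P theta))^-1)); last by rewrite E2 mul1r mulNr.
  apply: (ev (fun h => det (P theta) (P (theta + h)) / h *
    (- ((P theta).2 + chord_slope (P theta) (P (theta + h)) * (P theta).1) /
    pairing (P theta) (P theta)))).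
    move=> h h0 hd D0; rewrite /gcos; have [-> _] := chordE D0 (lt0r_neq0 n0).
    by ring.
  apply: cvgM => //; apply: cvgM; last exact: cvg_cst.
  by apply: cvgN; apply: cvgD; [exact: cvg_cst|apply: cvgM => //; exact: cvg_cst].
rewrite (_ : Q.1 = 1 * (((P theta).1 - det (P theta) Q * (P theta).2) *
  (pairing (P theta) (P theta))^-1)); last by rewrite mul1r.
apply: (ev (fun h => det (P theta) (P (theta + h)) / h *
  (((P theta).1 - chord_slope (P theta) (P (theta + h)) * (P theta).2) /
  pairing (P theta) (P theta)))).
  move=> h h0 hd D0; rewrite /gsin; have [_ ->] := chordE D0 (lt0r_neq0 n0).
  by ring.
apply: cvgM => //; apply: cvgM; last exact: cvg_cst.
by apply: cvgB; [exact: cvg_cst|apply: cvgM => //; exact: cvg_cst].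
Qed.

End Derivatives.

(** * Derivative intervals and faces of the polar *)

Section SidedDerivatives.
Context {R : realType}.
Implicit Types (K : set (R * R)) (theta h x l r v : R) (Q : R * R).

Lemma side1 : side (1 : R) = 0^'+.
Proof.
have e : (fun h : R => is_true (0 < 1 * h)) = (fun h => is_true (0 < h)).
  by apply/funext => h; rewrite mul1r.
by rewrite /side e.
Qed.

Lemma sideN1 : side (-1 : R) = 0^'-.
Proof.
have e : (fun h : R => is_true (0 < -1 * h)) = (fun h => is_true (h < 0)).
  by apply/funext => h; rewrite mulN1r oppr_gt0.
by rewrite /side e.
Qed.

(** The parameter c spares the distinction between the two orders of the endpoints. *)
Lemma betweenP l r v : Num.min l r <= v <= Num.max l r <->
  exists2 c, 0 <= c <= 1 & v = c * l + (1 - c) * r.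
Proof.
split.
  have [->|lr] := eqVneq l r.
    rewrite minxx maxxx => vr; exists 1; rewrite ?ler01 ?lexx//.
    by rewrite subrr mul0r addr0 mul1r; apply/eqP; rewrite eq_le andbC.
  move=> h; exists ((v - r) / (l - r)); last first.
    by field; rewrite subr_eq0.
  move: h; have [lr'|rl|e] := ltgtP l r; last by rewrite e eqxx in lr.
    move=> /andP[lv vr]; rewrite -[_ / _]opprK -mulrN -invrN opprB -mulNr opprB.
    rewrite divr_ge0 ?subr_ge0 ?(ltW lr')//= ler_pdivrMr ?subr_gt0//; lra.
  move=> /andP[rv vl].
  rewrite divr_ge0 ?subr_ge0 ?(ltW rl)//= ler_pdivrMr ?subr_gt0//; lra.
move=> [c /andP[c0 c1] ->].
have [lr|rl] := leP l r; apply/andP; split.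
- by have := mulr_ge0 (_ : 0 <= 1 - c) (_ : 0 <= r - l); rewrite !subr_ge0 => /(_ c1 lr); lra.
- by have := mulr_ge0 c0 (_ : 0 <= r - l); rewrite !subr_ge0 => /(_ lr); lra.
- by have := mulr_ge0 c0 (_ : 0 <= l - r); rewrite !subr_ge0 => /(_ (ltW rl)); lra.
- by have := mulr_ge0 (_ : 0 <= 1 - c) (_ : 0 <= l - r); rewrite !subr_ge0 => /(_ c1 (ltW rl)); lra.
Qed.

Lemma deriv_itvE (f : R -> R) x l r : is_lderive f x l -> is_rderive f x r ->
  deriv_itv f x = [set v | Num.min l r <= v <= Num.max l r].
Proof.
move=> fl fr; apply/seteqP; split => [v [l' [r' [fl' fr']]]|v lr]; last by exists l, r.
have -> : l' = l by apply: cvg_unique fl' fl; exact: norm_hausdorff.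
have -> // : r' = r by apply: cvg_unique fr' fr; exact: norm_hausdorff.
Qed.

Lemma bdpoint_derivatives K theta : convex_body K -> exists Ql Qr,
  [/\ face K theta Ql, face K theta Qr,
      is_lderive (gcos K) theta (- Ql.2) /\ is_lderive (gsin K) theta Ql.1,
      is_rderive (gcos K) theta (- Qr.2) /\ is_rderive (gsin K) theta Qr.1 &
      forall Q, face K theta Q ->
        det (bdpoint K theta) Ql <= det (bdpoint K theta) Q <= det (bdpoint K theta) Qr].
Proof.
move=> bK.
have [Ql FQl Qlmin] := face_extreme bK theta (-1).
have [Qr FQr Qrmax] := face_extreme bK theta 1.
exists Ql, Qr; split => //.
- have := bdpoint_side_derivative bK (_ : -1 * -1 = 1) FQl Qlmin.
  by rewrite sideN1 mulrNN mul1r; exact.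
- have := bdpoint_side_derivative bK (_ : 1 * 1 = 1) FQr Qrmax.
  by rewrite side1 mul1r; exact.
- move=> Q FQ; have := Qlmin Q FQ; have := Qrmax Q FQ.
  by rewrite !mulN1r !mul1r lerN2 => -> ->.
Qed.

Lemma face_segment K theta Ql Qr : convex_body K ->
  face K theta Ql -> face K theta Qr ->
  (forall Q, face K theta Q ->
    det (bdpoint K theta) Ql <= det (bdpoint K theta) Q <= det (bdpoint K theta) Qr) ->
  forall Q, face K theta Q <-> exists2 c, 0 <= c <= 1 &
    Q = (c * Ql.1 + (1 - c) * Qr.1, c * Ql.2 + (1 - c) * Qr.2).
Proof.
move=> bK [Kl l1] [Kr r1] ext Q; split; last first.
  move=> [c c01 ->]; split; first exact: body_conv (polar_body bK) Kl Kr c01.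
  rewrite [LHS](_ : _ = c * pairing Ql (bdpoint K theta) +
    (1 - c) * pairing Qr (bdpoint K theta)); last by rewrite /pairing /=; ring.
  by rewrite l1 r1; ring.
move=> FQ; have /andP[lQ Qr'] := ext Q FQ; have [KQ Q1] := FQ.
have n0 := lt0r_neq0 (boundary_pairing_gt0 bK (bdpoint_boundary bK theta)).
have /betweenP[c c01 gE] : Num.min (det (bdpoint K theta) Ql) (det (bdpoint K theta) Qr)
    <= det (bdpoint K theta) Q <=
    Num.max (det (bdpoint K theta) Ql) (det (bdpoint K theta) Qr).
  by rewrite (min_l (le_trans lQ Qr')) (max_r (le_trans lQ Qr')) lQ.
exists c => //; rewrite [LHS]surjective_pairing.
have [-> ->] := covectorE n0 Q1; have [-> ->] := covectorE n0 l1.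
by have [-> ->] := covectorE n0 r1; rewrite gE; congr pair; field.
Qed.

Lemma deriv_itv_face K theta : convex_body K ->
  deriv_itv (gcos K) theta = [set - Q.2 | Q in face K theta] /\
  deriv_itv (gsin K) theta = [set Q.1 | Q in face K theta].
Proof.
move=> bK; have [Ql [Qr [FQl FQr [cl sl] [cr sr] ext]]] := bdpoint_derivatives theta bK.
have seg := face_segment bK FQl FQr ext.
rewrite (deriv_itvE cl cr) (deriv_itvE sl sr).
split; apply/seteqP; split => v.
- move=> /betweenP[c c01 ->].
  exists (c * Ql.1 + (1 - c) * Qr.1, c * Ql.2 + (1 - c) * Qr.2) => /=; last by ring.
  by apply/seg; exists c.
- by move=> [Q /seg[c c01 ->] <-]; apply/betweenP; exists c => //=; ring.
- move=> /betweenP[c c01 ->].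
  exists (c * Ql.1 + (1 - c) * Qr.1, c * Ql.2 + (1 - c) * Qr.2) => //=.
  by apply/seg; exists c.
- by move=> [Q /seg[c c01 ->] <-]; apply/betweenP; exists c.
Qed.

Lemma open_rat_point (U : set (R * R)) (y : R * R) : U° y ->
  exists q : rat * rat, U (ratr q.1, ratr q.2).
Proof.
move=> /interior_box[e e0 eU].
have [p] := @rat_in_itvoo R y.1 (y.1 + e) ltac:(lra).
have [q] := @rat_in_itvoo R y.2 (y.2 + e) ltac:(lra).
rewrite !in_itv /= => /andP[q1 q2] /andP[p1 p2]; exists (p, q).
by apply: eU; rewrite /= ger0_norm; lra.
Qed.

(** The open triangle with vertices 0, Q1 and Q2, when <Q1, P> = <Q2, P> = 1. *)
Definition face_triangle (P Q1 Q2 : R * R) : set (R * R) :=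
  [set y | [/\ 0 < det Q1 y, 0 < det y Q2 & pairing P y < 1]].

Lemma face_triangle_rat (P Q1 Q2 : R * R) : 0 < det Q1 Q2 ->
  pairing Q1 P = 1 -> pairing Q2 P = 1 ->
  exists q : rat * rat, face_triangle P Q1 Q2 (ratr q.1, ratr q.2).
Proof.
move=> D0 e1 e2.
apply: (@open_rat_point _ ((Q1.1 + Q2.1) / 4, (Q1.2 + Q2.2) / 4)).
suff o : open (face_triangle P Q1 Q2).
  apply: open_nbhs_nbhs; split => //; split.
  - rewrite [ltRHS](_ : _ = det Q1 Q2 / 4) ?divr_gt0//.
    by rewrite /det /=; ring.
  - rewrite [ltRHS](_ : _ = det Q1 Q2 / 4) ?divr_gt0//.
    by rewrite /det /=; ring.
  - rewrite [ltLHS](_ : _ = (pairing Q1 P + pairing Q2 P) / 4).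
      by rewrite e1 e2; lra.
    by rewrite /pairing /=; ring.
have op (a b c : R) : open [set y : R * R | a * y.1 + b * y.2 < c].
  have /continuousP := @linear_form_continuous R a b.
  by move=> /(_ _ (@open_lt R c)).
rewrite (_ : face_triangle P Q1 Q2 = [set y | Q1.2 * y.1 + - Q1.1 * y.2 < 0] `&`
   [set y | - Q2.2 * y.1 + Q2.1 * y.2 < 0] `&` [set y | P.1 * y.1 + P.2 * y.2 < 1]).
  by apply: openI => //; apply: openI.
apply/seteqP; split => y; rewrite /face_triangle /det /pairing /=.
  by move=> [y1 y2 y3]; split; [split|]; lra.
by move=> [[y1 y2] y3]; split; lra.
Qed.

Lemma face_det K theta Q1 Q2 : convex_body K -> face K theta Q1 -> face K theta Q2 ->
  det (bdpoint K theta) Q1 < det (bdpoint K theta) Q2 -> 0 < det Q1 Q2.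
Proof.
move=> bK [_ e1] [_ e2] lt.
have n0 := boundary_pairing_gt0 bK (bdpoint_boundary bK theta).
rewrite -(pmulr_rgt0 _ n0).
have -> : pairing (bdpoint K theta) (bdpoint K theta) * det Q1 Q2 =
    pairing Q1 (bdpoint K theta) * det (bdpoint K theta) Q2 -
    pairing Q2 (bdpoint K theta) * det (bdpoint K theta) Q1.
  by rewrite /pairing /det; ring.
by rewrite e1 e2 !mul1r subr_gt0.
Qed.

(** A point y in both triangles is a positive combination of Q1 and Q2, so that
<P', y> <= <P, y>, and conversely.  Hence equality holds, which forces P' to take
the value 1 at Q1 and Q2, as P does; these two conditions determine a point. *)
Lemma face_triangle_inj (P P' Q1 Q2 Q1' Q2' y : R * R) :
  0 < det Q1 Q2 -> 0 < det Q1' Q2' ->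
  pairing Q1 P = 1 -> pairing Q2 P = 1 -> pairing Q1' P' = 1 -> pairing Q2' P' = 1 ->
  pairing Q1 P' <= 1 -> pairing Q2 P' <= 1 -> pairing Q1' P <= 1 -> pairing Q2' P <= 1 ->
  face_triangle P Q1 Q2 y -> face_triangle P' Q1' Q2' y -> P = P'.
Proof.
move=> D0 D0' e1 e2 e1' e2' l1 l2 l1' l2' [y1 y2 _] [y1' y2' _].
have expand (A B X : R * R) :
    pairing X y * det A B = det y B * pairing A X + det A y * pairing B X.
  by rewrite /pairing /det; ring.
have le : pairing P' y <= pairing P y.
  rewrite -(ler_pM2r D0) !expand e1 e2.
  by have := ler_wpM2l (ltW y2) l1; have := ler_wpM2l (ltW y1) l2; lra.
have le' : pairing P y <= pairing P' y.
  rewrite -(ler_pM2r D0') !expand e1' e2'.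
  by have := ler_wpM2l (ltW y2') l1'; have := ler_wpM2l (ltW y1') l2'; lra.
have := expand Q1 Q2 P'; rewrite (_ : pairing P' y = pairing P y); last first.
  by apply/eqP; rewrite eq_le le.
rewrite expand e1 e2 => eq.
have f1 : pairing Q1 P' = 1.
  apply/eqP; rewrite eq_le l1 -(ler_pM2l y2).
  by have := ler_wpM2l (ltW y1) l2; lra.
have f2 : pairing Q2 P' = 1.
  apply/eqP; rewrite eq_le l2 -(ler_pM2l y1).
  by have := ler_wpM2l (ltW y2) l1; lra.
have cramer (X : R * R) : X.1 * det Q1 Q2 = pairing Q1 X * Q2.2 - pairing Q2 X * Q1.2 /\
    X.2 * det Q1 Q2 = pairing Q2 X * Q1.1 - pairing Q1 X * Q2.1.
  by rewrite /pairing /det; split; ring.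
have [c1 c2] := cramer P; have [c1' c2'] := cramer P'.
rewrite [LHS]surjective_pairing [RHS]surjective_pairing.
congr pair; apply: (mulIf (lt0r_neq0 D0)).
  by rewrite c1 c1' e1 e2 f1 f2.
by rewrite c2 c2' e1 e2 f1 f2.
Qed.

Definition corner K : set R :=
  [set theta | exists Q1 Q2, [/\ face K theta Q1, face K theta Q2 &
    det (bdpoint K theta) Q1 < det (bdpoint K theta) Q2]].

(** A parameter with a nondegenerate face is determined by a rational point of the open
triangle of this face, which determines the boundary point, and by an integer
part that locates the parameter up to an interval where [bdpoint] is injective. *)
Lemma countable_corner K : convex_body K -> countable (corner K).
Proof.
move=> bK; have [d d0 dP] := bdpoint_local_sym bK.
have ex theta : exists q : rat * rat, corner K theta ->
    exists Q1 Q2, [/\ face K theta Q1, face K theta Q2, 0 < det Q1 Q2 &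
      face_triangle (bdpoint K theta) Q1 Q2 (ratr q.1, ratr q.2)].
  have [[Q1 [Q2 [F1 F2 lt]]]|nc] := pselect (corner K theta); last by exists (0, 0).
  have D0 := face_det bK F1 F2 lt.
  have [q qP] := face_triangle_rat D0 F1.2 F2.2.
  by exists q => _; exists Q1, Q2.
have [f fP] := choice ex.
apply/countable_injP.
exists (fun theta => pickle (f theta, Num.floor (theta / d))).
move=> t1 t2 /set_mem N1 /set_mem N2 /(pcan_inj pickleK)[fE kE].
have close : `|t1 - t2| < d.
  have := floor_itv (t1 / d); have := floor_itv (t2 / d); rewrite kE intrD.
  rewrite !ler_pdivlMr// !ltr_pdivrMr// mulrDl mul1r => /andP[? ?] /andP[? ?].
  by rewrite ltr_norml; apply/andP; split; lra.
have [Q1 [Q2 [[K1 e1] [K2 e2] D0 y]]] := fP t1 N1.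
have [Q1' [Q2' [[K1' e1'] [K2' e2'] D0' y']]] := fP t2 N2.
have PE : bdpoint K t1 = bdpoint K t2.
  rewrite -fE in y'; apply: (face_triangle_inj D0 D0' e1 e2 e1' e2' _ _ _ _ y y').
  - exact: K1 (bdpoint_in bK t2).
  - exact: K2 (bdpoint_in bK t2).
  - exact: K1' (bdpoint_in bK t1).
  - exact: K2' (bdpoint_in bK t1).
apply/eqP; apply: contraT => t12.
have [||_ /andP[]] := dP t2 (t1 - t2); [by rewrite subr_eq0|by []|].
rewrite (_ : t2 + (t1 - t2) = t1); last by ring.
by rewrite PE (_ : det _ _ = 0) ?mul0r ?ltxx// /det; ring.
Qed.

Lemma has_sided_derivs_bdpoint K : convex_body K ->
  has_sided_derivs (gcos K) /\ has_sided_derivs (gsin K).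
Proof.
move=> bK.
have ae (f : R -> R) (F : R * R -> R) :
    (forall theta, exists Ql Qr, [/\ face K theta Ql, face K theta Qr,
      is_lderive f theta (F Ql), is_rderive f theta (F Qr) &
      forall Q, face K theta Q -> det (bdpoint K theta) Ql <= det (bdpoint K theta) Q <=
        det (bdpoint K theta) Qr]) -> has_sided_derivs f.
  move=> fP; split.
    by move=> t; have [Ql [Qr [_ _ fl fr _]]] := fP t; split; eexists; eassumption.
  exists (corner K); split.
  - exact/countable_measurable/countable_corner.
  - exact/countable_lebesgue_measure0/countable_corner.
  move=> t /= nd; have [Ql [Qr [Fl Fr fl fr ext]]] := fP t.
  apply: contrapT => nc; apply: nd; exists (F Ql); split => //.
  suff -> : Ql = Qr by [].
  have gE : det (bdpoint K t) Ql = det (bdpoint K t) Qr.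
    apply/eqP; rewrite eq_le; have /andP[_ ->] := ext _ Fl => /=.
    by rewrite leNgt; apply/negP => lt; apply: nc; exists Ql, Qr.
  have n0 := lt0r_neq0 (boundary_pairing_gt0 bK (bdpoint_boundary bK t)).
  rewrite [LHS]surjective_pairing [RHS]surjective_pairing.
  have [-> ->] := covectorE n0 Fl.2; have [-> ->] := covectorE n0 Fr.2.
  by rewrite gE.
split; [apply: (ae _ (fun Q => - Q.2))|apply: (ae _ fst)] => theta;
  by have [Ql [Qr [FQl FQr [cl sl] [cr sr] ext]]] := bdpoint_derivatives theta bK;
  exists Ql, Qr.
Qed.

(** The maximum of a boundary covector of the polar on K is 1, by duality. *)
Lemma correspP K theta theta' : convex_body K ->
  corresp K theta theta' <-> pairing (bdpoint (polar K) theta') (bdpoint K theta) = 1.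
Proof.
move=> bK; have bK' := polar_body bK.
have [Q [KQ Q1]] := face_neq0 bK' theta'.
have KQ' := bdpoint_in bK' theta'.
rewrite (bipolar bK) in KQ.
have le1 : pairing (bdpoint (polar K) theta') (bdpoint K theta) <= 1.
  exact: KQ' (bdpoint_in bK theta).
split=> [[_ ub]|P1].
  apply/eqP; rewrite eq_le le1 /=; apply: ub.
  by exists Q; rewrite // pairingC.
rewrite /corresp P1; split; first by exists (bdpoint K theta) => //; exact: bdpoint_in.
by move=> _ [x Kx <-]; exact: KQ'.
Qed.

Lemma corresp_polar K theta theta' : convex_body K ->
  corresp (polar K) theta' theta = corresp K theta theta'.
Proof.
move=> bK; apply/propext; split.
  move=> /(correspP _ _ (polar_body bK)).
  by rewrite (bipolar bK) pairingC => h; apply/(correspP _ _ bK).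
move=> /(correspP _ _ bK) h; apply/(correspP _ _ (polar_body bK)).
by rewrite (bipolar bK) pairingC.
Qed.

(** By the bipolar theorem, a covector of the face is exposed by P(theta) as a point of
the polar of K', so it is on the boundary of K'. *)
Lemma face_image K theta : convex_body K ->
  face K theta = [set bdpoint (polar K) theta' | theta' in [set theta' | corresp K theta theta']].
Proof.
move=> bK; have bK' := polar_body bK; apply/seteqP; split => Q.
  move=> [KQ Q1].
  have bQ : boundary (polar K) Q.
    apply: (polar_boundary bK' KQ (Q := bdpoint K theta)); last by rewrite pairingC.
    by rewrite (bipolar bK); exact: bdpoint_in.
  have [t tE] := bdpoint_surj bK' bQ.
  by exists t; [apply/(correspP _ _ bK); rewrite tE|exact: tE].
move=> [t /(correspP _ _ bK) h <-]; split; last exact: h.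
exact: bdpoint_in bK' t.
Qed.

Lemma deriv_itv_corresp K theta : convex_body K ->
  deriv_itv (gcos K) theta = [set - gsin (polar K) theta'
    | theta' in [set theta' | corresp K theta theta']] /\
  deriv_itv (gsin K) theta = [set gcos (polar K) theta'
    | theta' in [set theta' | corresp K theta theta']].
Proof.
move=> bK; have [-> ->] := deriv_itv_face theta bK.
by rewrite (face_image theta bK) !image_comp.
Qed.

Lemma lipschitz_of_bound (f : R -> R) (C : R) :
  (forall x y, `|f x - f y| <= C * `|x - y|) -> [lipschitz f x | x in [set: R]].
Proof.
move=> fC; exists C; split; first exact: num_real.
move=> M CM [x y] _ /=; apply: le_trans (fC x y) _.
by rewrite ler_wpM2r// ltW.
Qed.

End SidedDerivatives.

Theorem theorem2 (R : realType) (Omega : set (R * R)) :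
  convex_set Omega -> compact Omega -> Omega° 0 ->
  [/\ [lipschitz (gcos Omega theta) | theta in [set: R]],
      [lipschitz (gsin Omega theta) | theta in [set: R]],
      has_sided_derivs (gcos Omega)
    & has_sided_derivs (gsin Omega)] /\
  [/\ forall theta theta', corresp Omega theta theta' ->
        deriv_itv (gcos Omega) theta (- gsin (polar Omega) theta') /\
        deriv_itv (gsin Omega) theta (gcos (polar Omega) theta'),
      forall theta,
        deriv_itv (gcos Omega) theta =
          [set - gsin (polar Omega) theta'
            | theta' in [set theta' | corresp Omega theta theta']] /\
        deriv_itv (gsin Omega) theta =
          [set gcos (polar Omega) theta'
            | theta' in [set theta' | corresp Omega theta theta']]
    & forall theta',
        deriv_itv (gcos (polar Omega)) theta' =
          [set - gsin Omega theta
            | theta in [set theta | corresp Omega theta theta']] /\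
        deriv_itv (gsin (polar Omega)) theta' =
          [set gcos Omega theta
            | theta in [set theta | corresp Omega theta theta']]].
Proof.
move=> cO kO iO; have bO := ConvexBody cO kO iO.
have [C C0 lip] := bdpoint_lipschitz bO; have [dc ds] := has_sided_derivs_bdpoint bO.
split.
  split => //; apply: (@lipschitz_of_bound _ _ C) => x y; [exact: (lip x y).1|exact: (lip x y).2].
split=> [theta theta' cor|theta|theta'].
- by have [-> ->] := deriv_itv_corresp theta bO; split; exists theta'.
- exact: deriv_itv_corresp.
- have E : [set theta | corresp (polar Omega) theta' theta] =
      [set theta | corresp Omega theta theta'].
    by apply/funext => theta; exact: (corresp_polar theta theta' bO).
  rewrite -E; have := deriv_itv_corresp theta' (polar_body bO).
  by rewrite (bipolar bO); apply.
Qed.
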